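(* Let $I \subset \mathbb{R}$ be a compact interval, let $\mathcal{F}$ be a set of $n$ 1-independent analytic functions, and let $A$ be a finite subset of $I$. Then there is a function $f \in \mathcal{F}$ satisfying $$|2^{n-1}f(A)-(2^{n-1}-1)f(A)|\gg_{\mathcal{F},I} |A|^{\phi(n)},$$ where $\phi:\mathbb{N} \to \mathbb{R}$ is given by $\phi(1)=1$ and $\phi(n)=1+\frac{1}{1+\frac{1}{\phi(n-1)}}$ for $n\geq 2$.
   Context: For finite $B \subset \mathbb{R}$ and positive integers $s,t$, $sB - tB$ denotes the set of all $b_1+\dots+b_s - b_1'-\dots-b_t'$ with all $b_i, b_j' \in B$ (and $1B-0B=B$). ''Analytic'' means real analytic on an open interval containing $I$. A set $\{f_1,\dots,f_n\}$ of analytic functions is called 1-independent if its derivatives $f_1',\dots,f_n'$ are linearly independent over $\mathbb{R}$. $X \gg_{z} Y$ means $X \geq C(z)\, Y$ for some positive constant $C(z)$ depending only on $z$. *)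

(* Defs.v *)
From HB Require Import structures.
From mathcomp Require Import all_boot all_order all_algebra finmap.
From mathcomp Require Import all_classical all_reals all_analysis.

Set Implicit Arguments.
Unset Strict Implicit.
Unset Printing Implicit Defensive.

Import Order.TTheory GRing.Theory Num.Theory numFieldNormedType.Exports.

Local Open Scope classical_set_scope.
Local Open Scope ring_scope.

Definition analytic_at (R : realType) (f : R -> R) (x0 : R) : Prop :=
  exists2 r : R, 0 < r & exists c : nat -> R,
    forall x, `|x - x0| < r -> pseries c (x - x0) @ \oo --> f x.

Definition analytic_on (R : realType) (D : set R) (f : R -> R) : Prop :=
  forall x, D x -> analytic_at f x.

Definition linearly_independent_on (R : realType) (D : set R) (n : nat)
    (g : 'I_n -> R -> R) : Prop :=
  forall c : 'I_n -> R,
    (forall x, D x -> \sum_(i < n) c i * g i x = 0) -> forall i, c i = 0.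

Definition one_independent_on (R : realType) (D : set R) (n : nat)
    (f : 'I_n -> R -> R) : Prop :=
  linearly_independent_on D (fun i => derive1 (f i)).

(* s B - t B; the value at (s, t) = (1, 0) is B, since empty sums are 0. *)
Definition sumdiff (R : realType) (s t : nat) (B : {fset R}) : {fset R} :=
  [fset \sum_(i < s) fsval (tnth u i) - \sum_(j < t) fsval (tnth v j)
    | u in {: s.-tuple B}, v in {: t.-tuple B}]%fset.

(* The value at 0 is a dummy: the recursion starts at phi 1 = 1. *)
Fixpoint phi (R : realType) (n : nat) : R :=
  match n with
  | 0%N | 1%N => 1
  | m.+1 => 1 + 1 / (1 + 1 / phi R m)
  end.

Lemma sumdiff10 (R : realType) (B : {fset R}) : sumdiff 1 0 B = B.
Proof.
apply/fsetP => x; apply/imfset2P/idP => [[u _ [v _ ->]]|xB].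
  by rewrite big_ord1 big_ord0 subr0 (valP (tnth u ord0)).
exists [tuple [` xB]%fset] => //.
exists [tuple] => //.
by rewrite big_ord1 big_ord0 subr0.
Qed.

Lemma phi1 (R : realType) : phi R 1 = 1.
Proof. by []. Qed.

Lemma phiS (R : realType) (n : nat) :
  (1 < n)%N -> phi R n = 1 + 1 / (1 + 1 / phi R n.-1).
Proof. by case: n => [|[|n]]. Qed.

(* Main.v *)
(* Near a point [x0] (on either side of it, with [x] the distance to [x0])
   Gaussian elimination on the power series of the derivatives writes, after
   reordering, [f_i' = \sum_(j <= i) L i j * e_j] where [L] is triangular and
   [e_j] behaves like [c_j x^(mu_j)], together with its derivatives, for strictly
   increasing exponents [mu_j]. The bound is proved by induction on the number
   of functions, uniformly over all such systems on a small interval [(0, dl)].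

   Let [nxt a] be the successor of [a] in [A]. If the gaps
   [f_0 (nxt a) - f_0 a] have large rank among all gaps, adding to [f_0 a] the
   gaps that are at most its own gap already gives many elements of
   [2 f_0(A) - f_0(A)]. Otherwise few values [d] of the gap account for a positive
   proportion of [A]. On the set where the gap is [d], the functions
   [f_i (nxt a) - f_i a], [i > 0], extend to [f_i (s x) - f_i x] with
   [f_0 (s x) = f_0 x + d]; divided by [d] they form a system of the same shape
   with exponents [mu_j - mu_0 - 1], uniformly in [d] as soon as [d] is small
   compared to [x^(mu_0 + 1)], which only excludes boundedly many points for each
   [d]. The elements produced by the induction hypothesis stay between the
   extreme values of these differences, so by monotonicity they can be added to
   [f_i a] without leaving the interval up to [f_i (nxt a)]. Balancing the two
   cases gives the recursion for [phi]. Compactness of [[a, b]] concludes. *)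

Require Import Defs.
From HB Require Import structures.
From mathcomp Require Import all_boot all_order all_algebra finmap.
From mathcomp Require Import all_classical all_reals all_analysis.
From mathcomp Require Import zify ring lra.

Import Order.TTheory GRing.Theory Num.Theory numFieldNormedType.Exports.

Local Open Scope classical_set_scope.
Local Open Scope ring_scope.

(** * Iterated sumsets and their part inside the span of the set *)

Section Sumdiff.
Set Implicit Arguments.
Unset Strict Implicit.
Context {R : realType}.
Implicit Types (B D : {fset R}) (s t k m : nat).

Lemma lift_seq_fset B (u : seq R) :
  {subset u <= B} -> exists w : seq B, map (@fsval _ B) w = u.
Proof.
elim: u => [|x u IH] uB; first by exists [::].
have [y yu|w <-] := IH; first by apply: uB; rewrite inE yu orbT.
have xB : x \in B by apply: uB; rewrite inE eqxx.
by exists ([` xB]%fset :: w).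
Qed.

(** Plain sequences replace tuples over the subtype, so that concatenating and padding need no
    casts. *)
Lemma sumdiffP s t B (z : R) :
  reflect (exists u v : seq R, [/\ size u = s, size v = t,
      {subset u <= B}, {subset v <= B}
    & z = \sum_(x <- u) x - \sum_(x <- v) x]) (z \in sumdiff s t B).
Proof.
apply: (iffP idP).
  case/imfset2P => u _ [v _ ->].
  exists (map (@fsval _ B) u), (map (@fsval _ B) v); split.
  - by rewrite size_map size_tuple.
  - by rewrite size_map size_tuple.
  - by move=> x /mapP[y _ ->]; exact: valP.
  - by move=> x /mapP[y _ ->]; exact: valP.
  - by rewrite !big_map !big_tuple.
case=> u [v [<- <- /lift_seq_fset[u' <-] /lift_seq_fset[v' <-] ->]].
apply/imfset2P.
exists (tcast (esym (size_map _ _)) (in_tuple u')) => //.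
exists (tcast (esym (size_map _ _)) (in_tuple v')) => //.
by rewrite -!(big_tuple _ _ _ xpredT) !val_tcast !big_map.
Qed.

Lemma sumdiffS s t B B' : (B `<=` B')%fset ->
  (sumdiff s t B `<=` sumdiff s t B')%fset.
Proof.
move=> /fsubsetP BB'; apply/fsubsetP => z /sumdiffP[u [v [su sv uB vB ->]]].
by apply/sumdiffP; exists u, v; split => // x /[dup] => [/uB|/vB] /BB'.
Qed.

Lemma sumdiff_pad s t k B (b z : R) : b \in B ->
  z \in sumdiff s t B -> z \in sumdiff (s + k) (t + k) B.
Proof.
move=> bB /sumdiffP[u [v [su sv uB vB ->]]].
have bkB (w : seq R) : {subset w <= B} -> {subset w ++ nseq k b <= B}.
  by move=> wB x; rewrite mem_cat => /orP[/wB//|/nseqP[->]].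
apply/sumdiffP; exists (u ++ nseq k b), (v ++ nseq k b).
split; rewrite ?size_cat ?size_nseq ?su ?sv //; try exact: bkB.
by rewrite !big_cat /=; ring.
Qed.

Lemma split_differences B (u : seq R) :
  {in u, forall x, exists b b', [/\ b \in B, b' \in B & x = b - b']} ->
  exists p q : seq R, [/\ size p = size u, size q = size u,
    {subset p <= B}, {subset q <= B}
    & \sum_(x <- u) x = \sum_(x <- p) x - \sum_(x <- q) x].
Proof.
elim: u => [|x u IH] uB.
  by exists [::], [::]; split => //; rewrite !big_nil subr0.
have [y yu|p [q [sp sq pB qB E]]] := IH.
  by apply: uB; rewrite inE yu orbT.
have [|b [b' [bB b'B xE]]] := uB x; first by rewrite inE eqxx.
exists (b :: p), (b' :: q); split; rewrite /= ?sp ?sq //.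
- by move=> y; rewrite inE => /predU1P[->//|/pB].
- by move=> y; rewrite inE => /predU1P[->//|/qB].
- by rewrite !big_cons E xE; ring.
Qed.

(** Each of the [s + t] differences contributes one point of [B] with each sign. With [s = 2 ^ m]
    and [t = 2 ^ m - 1] the result has [2 ^ m.+1] and [2 ^ m.+1 - 1] terms: this is how the number
    of summands doubles at each induction step. *)
Lemma sumdiff_differences s t B D (b z : R) :
  {in D, forall x, exists b b', [/\ b \in B, b' \in B & x = b - b']} ->
  b \in B -> z \in sumdiff s t D -> b + z \in sumdiff (s + t).+1 (s + t) B.
Proof.
move=> DB bB /sumdiffP[u [v [su sv uD vD ->]]].
have [x /uD /DB//|p [q [sp sq pB qB ->]]] := @split_differences B u.
have [x /vD /DB//|p' [q' [sp' sq' pB' qB' ->]]] := @split_differences B v.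
apply/sumdiffP; exists (b :: p ++ q'), (q ++ p'); split.
- by rewrite /= size_cat sp sq' su sv.
- by rewrite size_cat sp' sq su sv.
- by move=> x; rewrite inE mem_cat => /predU1P[->//|/orP[/pB|/qB']].
- by move=> x; rewrite mem_cat => /orP[/qB|/pB'].
- by rewrite big_cons !big_cat /=; ring.
Qed.

Definition between B (z : R) :=
  has (fun b => b <= z) B && has (fun b => z <= b) B.

Lemma betweenP B z :
  reflect (exists b b', [/\ b \in B, b' \in B & b <= z <= b']) (between B z).
Proof.
apply: (iffP andP).
  by case=> /hasP[b bB h] /hasP[b' b'B h']; exists b, b'; rewrite h h'.
by case=> b [b' [bB b'B /andP[h h']]]; split; apply/hasP; [exists b|exists b'].
Qed.

(** The induction runs on this smaller set: only elements between two points of [B] can be added to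
    a value of a function without passing the next value. *)
Definition sumdiff_between m B : {fset R} :=
  [fset z in sumdiff (2 ^ m) (2 ^ m - 1) B | between B z]%fset.

Lemma sumdiff_betweenP m B (z : R) : reflect
  (z \in sumdiff (2 ^ m) (2 ^ m - 1) B /\ between B z)
  (z \in sumdiff_between m B).
Proof. by rewrite /sumdiff_between !inE /=; exact: andP. Qed.

Lemma sub_sumdiff_between m B : (B `<=` sumdiff_between m B)%fset.
Proof.
apply/fsubsetP => b bB; apply/sumdiff_betweenP; split; last first.
  by apply/betweenP; exists b, b; rewrite lexx.
have -> : (2 ^ m = 1 + (2 ^ m - 1))%N by rewrite subnKC ?expn_gt0.
rewrite addKn -{2}(add0n (2 ^ m - 1)%N).
by apply: (sumdiff_pad _ bB); rewrite sumdiff10.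
Qed.

(** Allows normalising signs and dividing by a gap; a negative factor exchanges the two bounding
    points. *)
Lemma card_sumdiff_betweenZ m (f : R -> R) (a : R) (A : {fset R}) : a != 0 ->
  (#|` sumdiff_between m (f @` A)%fset| <=
   #|` sumdiff_between m ((fun x => (a * f x)%R) @` A)%fset|)%N.
Proof.
move=> a0; set B := (f @` A)%fset; set B' := (_ @` A)%fset.
have BB' b : b \in B -> a * b \in B'.
  by move=> /imfsetP[x xA ->]; apply/imfsetP; exists x.
have <- : #|` ( *%R a @` sumdiff_between m B)%fset| = #|` sumdiff_between m B|.
  exact/card_imfset/mulfI.
apply: fsubset_leq_card; apply/fsubsetP => z /imfsetP[{}z zB ->].
have /sumdiff_betweenP[/sumdiffP[u [v [su sv uB vB E]]] /betweenP[b [b' []]]] := zB.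
move=> bB b'B /andP[bz zb']; apply/sumdiff_betweenP; split.
  apply/sumdiffP; exists (map ( *%R a) u), (map ( *%R a) v).
  rewrite !size_map; split => //.
  - by move=> _ /mapP[y /uB yB ->]; exact: BB'.
  - by move=> _ /mapP[y /vB yB ->]; exact: BB'.
  - by rewrite E mulrBr !big_map !mulr_sumr.
apply/betweenP; have [apos|aneg|/eqP] := ltgtP 0 a; last by rewrite eq_sym (negPf a0).
  by exists (a * b), (a * b'); rewrite !BB' // !ler_pM2l // bz zb'.
by exists (a * b'), (a * b); rewrite !BB' // !ler_nM2l // bz zb'.
Qed.

Lemma sum_card_le (T : choiceType) (s : seq T) (E : T -> {fset R}) (S : {fset R}) :
  uniq s -> {in s, forall a, (E a `<=` S)%fset} ->
  {in s &, forall a a' z, z \in E a -> z \in E a' -> a = a'} ->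
  (\sum_(a <- s) #|` E a| <= #|` S|)%N.
Proof.
elim: s S => [|a s IH] S; first by rewrite big_nil.
move=> /= /andP[ains us] ES disj; rewrite big_cons.
have aS : (E a `<=` S)%fset by apply: ES; rewrite inE eqxx.
rewrite -(cardfsID (E a) S) (fsetIidPr aS) leq_add2l.
apply: IH => // [b bs|b c bs cs z]; last first.
  by apply: disj; rewrite inE ?bs ?cs orbT.
apply/fsubsetP => z zb; rewrite !inE.
have -> : z \in S by move: z zb; apply/fsubsetP/ES; rewrite inE bs orbT.
rewrite andbT; apply/negP => za; move: ains.
suff -> : a = b by rewrite bs.
by apply: (disj _ _ _ _ z) => //; rewrite inE ?eqxx ?bs ?orbT.
Qed.

(* Squeezing: the translates [g a + E a] fit in the disjoint half-open
   intervals between consecutive values of [g]. *)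
Lemma squeeze m (A A0 : {fset R}) (nxt g : R -> R) (E : R -> {fset R}) :
  (A0 `<=` A)%fset ->
  {in A0, forall a, nxt a \in A} ->
  {in A0 & A, forall a b, a < b -> nxt a <= b} ->
  {in A &, {homo g : x y / x <= y}} ->
  {in A0, forall a e, e \in E a -> 0 < e <= g (nxt a) - g a /\
     g a + e \in sumdiff (2 ^ m) (2 ^ m - 1) (g @` A)%fset} ->
  (\sum_(a <- A0) #|` E a| <= #|` sumdiff_between m (g @` A)%fset|)%N.
Proof.
move=> /fsubsetP A0A nA nle gm EP.
have inj a : injective (fun e => g a + e) by move=> x y /addrI.
rewrite (eq_bigr (fun a => #|` ((fun e => (g a + e)%R) @` E a)%fset|)); last first.
  by move=> a _; apply/esym/card_imfset/inj.
apply: sum_card_le => [|a aA0|a b aA0 bA0 z]; first exact: fset_uniq.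
  apply/fsubsetP => _ /imfsetP[e /= /EP [//|/andP[e0 el] eS] ->].
  apply/sumdiff_betweenP; split => //; apply/betweenP.
  exists (g a), (g (nxt a)); rewrite !in_imfset /= ?nA ?A0A //; split => //.
  by rewrite lerDl ltW //=; lra.
wlog ab : a b aA0 bA0 / a < b.
  move=> W zE zF; have [ab|ba|//] := ltgtP a b; first exact: (W a b).
  by apply/esym/(W b a).
move=> /imfsetP[e /= /EP [//|/andP[e0 el] _] ->].
move=> /imfsetP[e' /= /EP [//|/andP[e'0 _] _] E'].
have : g (nxt a) <= g b by apply: gm; rewrite ?nA ?A0A ?nle // A0A.
lra.
Qed.

End Sumdiff.

(** * The exponent recursion and growth on a level set of the gap *)

Section Step.
Set Implicit Arguments.
Unset Strict Implicit.
Context {R : realType}.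
Implicit Types (A X Y : {fset R}) (m : nat).

Lemma phi_ge1 m : 1 <= phi R m.+1.
Proof.
elim: m => [|m IH] //; rewrite phiS //= lerDl !divr_ge0 // addr_ge0 // divr_ge0 //.
by rewrite (le_trans ler01).
Qed.

Lemma phi_gt0 m : 0 < phi R m.+1.
Proof. by rewrite (lt_le_trans ltr01) ?phi_ge1. Qed.

Lemma powR_phiS m (N : R) : 0 < N -> exists u p : R,
  [/\ 0 < u, 0 < p, u * p = N, u `^ phi R m.+1 = p & N `^ phi R m.+2 = N * p].
Proof.
move=> N0; have f0 := phi_gt0 m; set f := phi R m.+1 in f0 *.
have f1 : 1 + f != 0 by rewrite gt_eqF // addr_gt0.
have [u0 p0] : 0 < N `^ (1 / (1 + f)) /\ 0 < N `^ (f / (1 + f)) by rewrite !powR_gt0.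
have f1' : f != 0 by rewrite gt_eqF.
exists (N `^ (1 / (1 + f))), (N `^ (f / (1 + f))); split => //.
- rewrite -powRD; last by rewrite (gt_eqF N0) implybT.
  by rewrite -mulrDl divff // powRr1 // ltW.
- by rewrite -powRrM mulrAC mul1r.
- rewrite phiS // [m.+2.-1]/= -/f powRD; last by rewrite (gt_eqF N0) implybT.
  rewrite powRr1 ?ltW //; congr (_ * _ `^ _).
  by field; rewrite f1 f1'.
Qed.

Lemma card_le_sum (T : choiceType) (s : seq T) (E : T -> {fset R}) (S : {fset R}) :
  {in S, forall z, exists2 a, a \in s & z \in E a} ->
  (#|` S| <= \sum_(a <- s) #|` E a|)%N.
Proof.
elim: s S => [|a s IH] S sE.
  rewrite big_nil leqn0 cardfs_eq0; apply/negPn/negP => /fset0Pn[z /sE[]//].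
rewrite big_cons -(cardfsID (E a) S) leq_add //.
  exact/fsubset_leq_card/fsubsetIr.
apply: IH => z; rewrite !inE => /andP[zE /sE[b]].
by rewrite inE => /predU1P[->|bs zb]; [rewrite (negPf zE)|exists b].
Qed.

Lemma ex_max_seq (s : seq R) : s != [::] ->
  exists2 x, x \in s & {in s, forall y, y <= x}.
Proof.
elim: s => //= x [|y s] IH _.
  by exists x; rewrite ?inE // => y; rewrite inE => /eqP->.
have [//|z zs zM] := IH; have [xz|zx] := leP x z.
  exists z; first by rewrite in_cons zs orbT.
  by move=> w; rewrite in_cons => /predU1P[->//|/zM].
exists x; rewrite ?inE ?eqxx // => w; rewrite in_cons => /predU1P[->//|/zM wz].
exact: le_trans wz (ltW zx).
Qed.

Definition below X (y : R) : {fset R} := [fset x in X | x < y]%fset.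

(** Cut the sorted list of [X] into runs of length [h]. The run [b 0] is discarded: its [h] elements
    lie below everything in the three runs that are kept. *)
Lemma split_blocks X h : (4 * h <= #|` X|)%N -> exists Y1 Y2 Y3 : {fset R},
  let Y := (Y1 `|` Y2 `|` Y3)%fset in
  [/\ (Y `<=` X)%fset, [/\ #|` Y1| = h, #|` Y2| = h & #|` Y3| = h],
    {in Y, forall y, h <= #|` below X y|}%N,
    {in Y1 & Y2, forall x y, x <= y} & {in Y2 & Y3, forall x y, x <= y}].
Proof.
move=> hX; pose s := sort <=%R (enum_fset X).
have ss : sorted <%R s by rewrite sort_lt_sorted fset_uniq.
have sz : size s = #|` X| by rewrite size_sort.
have us : uniq s by rewrite sort_uniq fset_uniq.
have sX x : (x \in s) = (x \in X) by rewrite mem_sort.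
pose b k := [fset x in take h (drop (k * h) s)]%fset.
have bP k x : x \in b k -> exists2 j, x = nth 0 s j &
    ((k * h <= j)%N && (j < k.+1 * h)%N && (j < size s)%N).
  move=> xb; have /(nthP 0)[j] : x \in take h (drop (k * h) s).
    by move: xb; rewrite inE.
  rewrite size_take_min size_drop leq_min ltn_subRL => /andP[jh js] <-.
  exists (k * h + j)%N; first by rewrite nth_take ?nth_drop.
  by rewrite leq_addr mulSn addnC ltn_add2r jh addnC js.
have bX k x : x \in b k -> x \in X by move=> /bP[j -> /andP[_ js]]; rewrite -sX mem_nth.
have cb k : (k < 4)%N -> #|` b k| = h.
  move=> k4; rewrite card_imfset //=.
  rewrite undup_id ?take_uniq ?drop_uniq // size_takel // size_drop sz.
  rewrite leq_subRL; last exact: leq_trans (leq_mul (ltnW k4) (leqnn h)) hX.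
  by apply: leq_trans hX; rewrite addnC -mulSn leq_mul.
have blt k l x y : (k < l)%N -> x \in b k -> y \in b l -> x < y.
  move=> kl /bP[i -> /andP[/andP[_ i2] i3]] /bP[j -> /andP[/andP[j1 _] j3]].
  rewrite lt_sorted_ltn_nth //; apply: leq_trans i2 (leq_trans _ j1).
  by rewrite leq_mul2r kl orbT.
have yE k y : (0 < k)%N -> y \in b k -> (h <= #|` below X y|)%N.
  move=> k0 yb; rewrite -(cb 0%N) //; apply/fsubset_leq_card/fsubsetP => x xb.
  by rewrite /below !inE (bX _ _ xb) (blt _ _ _ _ k0 xb yb).
exists (b 1), (b 2), (b 3); split; rewrite ?cb //.
- by apply/fsubsetP => x; rewrite !in_fsetU => /orP[/orP[]|] /bX.
- by move=> y; rewrite !in_fsetU => /orP[/orP[]|]; apply: yE.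
- by move=> x y xb yb; apply/ltW/(blt 1%N 2%N).
- by move=> x y xb yb; apply/ltW/(blt 2%N 3%N).
Qed.

(* The growth is extracted from the middle block and then added to the points
   of an outer block: which one depends on the direction of monotonicity of
   [G i], where [i] is only known afterwards. The first block is sacrificed to
   make [H] applicable. *)
Lemma level_set_growth m (R0 h : nat) (C' : R) X (G : nat -> R -> R) :
  (R0 <= h)%N -> (0 < h)%N -> (4 * h <= #|` X|)%N ->
  (forall Y, (Y `<=` X)%fset ->
    {in Y, forall y, R0 <= #|` below X y|}%N ->
    (forall i, (i <= m)%N -> {in Y &, {homo G i : x y / x <= y}} \/
                             {in Y &, {homo G i : x y /~ x <= y}}) /\
    (Y != fset0 -> exists2 i, (i <= m)%N & C' * #|` Y|%:R `^ phi R m.+1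
                          <= #|` sumdiff_between m (G i @` Y)%fset|%:R)) ->
  exists w : nat * {fset R} * {fset R},
    let: (i, T, E) := w in
    [/\ (i <= m)%N, (T `<=` X)%fset, (h <= #|` T|)%N,
        (E `<=` sumdiff (2 ^ m) (2 ^ m - 1) (G i @` X)%fset)%fset
      & C' * h%:R `^ phi R m.+1 <= #|` E|%:R /\
        {in T & E, forall a e, e <= G i a /\ exists2 x, x \in X & G i x <= e}].
Proof.
move=> Rh h0 hX H.
have [Y1 [Y2 [Y3 [/fsubsetP YX [c1 c2 c3] rY Y12 Y23]]]] := split_blocks hX.
have YX' : (Y1 `|` Y2 `|` Y3 `<=` X)%fset by apply/fsubsetP.
have Y1X x : x \in Y1 -> x \in X by move=> xY; apply: YX; rewrite !in_fsetU xY.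
have Y2X x : x \in Y2 -> x \in X by move=> xY; apply: YX; rewrite !in_fsetU xY orbT.
have Y2X' : (Y2 `<=` X)%fset by apply/fsubsetP.
have Y3X x : x \in Y3 -> x \in X by move=> xY; apply: YX; rewrite !in_fsetU xY orbT.
have r2 : {in Y2, forall y, R0 <= #|` below X y|}%N.
  by move=> y yY; apply: leq_trans Rh (rY y _); rewrite !in_fsetU yY orbT.
have [|i im iC] := (H Y2 Y2X' r2).2.
  by rewrite -cardfs_gt0 c2.
(* [H] is applied a second time, to the union of the blocks: comparing an outer block with [Y2]
   requires one direction of monotonicity valid on both. *)
have rY' : {in (Y1 `|` Y2 `|` Y3)%fset, forall y, R0 <= #|` below X y|}%N.
  by move=> y yY; apply: leq_trans Rh (rY y yY).
have [/(_ i im) mono _] := H _ YX' rY'.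
set E := sumdiff_between m (G i @` Y2)%fset in iC.
have E1 : (E `<=` sumdiff (2 ^ m) (2 ^ m - 1) (G i @` X)%fset)%fset.
  apply/fsubsetP => z /sumdiff_betweenP[zS _]; move: z zS; apply/fsubsetP/sumdiffS.
  by apply/fsubsetP => _ /imfsetP[x /Y2X xX ->]; apply/imfsetP; exists x.
have E2 e : e \in E -> exists y y', [/\ y \in Y2, y' \in Y2 & G i y <= e <= G i y'].
  case/sumdiff_betweenP => _ /betweenP[_ [_ [/imfsetP[y yY ->] /imfsetP[y' y'Y ->]]]].
  by exists y, y'.
rewrite c2 in iC.
have in1 x : x \in Y1 -> x \in (Y1 `|` Y2 `|` Y3)%fset by rewrite !in_fsetU => ->.
have in2 x : x \in Y2 -> x \in (Y1 `|` Y2 `|` Y3)%fset by rewrite !in_fsetU => ->; rewrite orbT.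
have in3 x : x \in Y3 -> x \in (Y1 `|` Y2 `|` Y3)%fset by rewrite !in_fsetU => ->; rewrite orbT.
case: mono => mono.
  exists (i, Y3, E); split; rewrite ?c3 //; first exact/fsubsetP.
  split => // a e aT /E2[y [y' [yY y'Y /andP[ye ey']]]]; split; last by exists y; rewrite ?Y2X.
  by apply: le_trans ey' (mono _ _ _ _ _); [exact: in2|exact: in3|exact: Y23].
exists (i, Y1, E); split; rewrite ?c1 //; first exact/fsubsetP.
split => // a e aT /E2[y [y' [yY y'Y /andP[ye ey']]]]; split; last by exists y; rewrite ?Y2X.
by apply: le_trans ey' (mono _ _ _ _ _); [exact: in2|exact: in1|exact: Y12].
Qed.

End Step.

(** * The combinatorial induction step *)

Section Growth.
Set Implicit Arguments.
Unset Strict Implicit.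
Context {R : realType}.
Implicit Types (A X Y : {fset R}) (m : nat).

Definition successor_on (A A0 : {fset R}) (nxt : R -> R) :=
  [/\ (A0 `<=` A)%fset, (#|` A| <= #|` A0|.+1)%N,
      {in A0, forall a, nxt a \in A /\ a < nxt a}
    & {in A0 & A, forall a b, a < b -> nxt a <= b}].

Lemma pigeonhole_fset (X : {fset R}) (m : nat) (c : R -> nat) :
  {in X, forall x, (c x <= m)%N} ->
  exists2 i, (i <= m)%N & (#|` X| <= m.+1 * #|` [fset x in X | c x == i]%fset|)%N.
Proof.
move=> cm; apply: contrapT => H.
have lt i : (i <= m)%N -> (m.+1 * #|` [fset x in X | c x == i]%fset| < #|` X|)%N.
  by move=> im; rewrite ltnNge; apply/negP => h; apply: H; exists i.
have le : (#|` X| <= \sum_(i < m.+1) #|` [fset x in X | c x == i]%fset|)%N.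
  rewrite -(big_mkord xpredT (fun i => #|` [fset x in X | c x == i]%fset|)).
  apply: card_le_sum => x xX.
  by exists (c x); rewrite ?mem_iota ?add0n ?subn0 ?ltnS ?cm // !inE xX eqxx.
have := leq_mul (leqnn m.+1) le; rewrite leqNgt => /negP; apply.
rewrite big_distrr /= -[X in (_ < X * _)%N]card_ord -sum_nat_const !big_ord_recl.
apply: (leq_add (lt 0%N isT)); apply: leq_sum => i _.
by apply/ltnW/lt; rewrite /= ltn_ord.
Qed.

Lemma sumr_const_seq (S : seq R) (c : R) : \sum_(a <- S) c = (size S)%:R * c.
Proof. by rewrite big_const_seq iter_addr addr0 count_predT mulr_natl. Qed.

Lemma card_mul_le_sum (S : seq R) (c : R) (g : R -> nat) :
  {in S, forall a, c <= (g a)%:R} -> (size S)%:R * c <= (\sum_(a <- S) g a)%:R.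
Proof.
move=> cg; rewrite natr_sum -sumr_const_seq big_seq [leRHS]big_seq.
exact: ler_sum.
Qed.

Lemma quarter_bounds (r q : nat) : (4 * r.+1 < q)%N ->
  [/\ r <= q %/ 4, 0 < q %/ 4, q <= 8 * (q %/ 4) & 4 * (q %/ 4) <= q]%N.
Proof. by move=> rq; split; lia. Qed.

Lemma double_pow2_pred m : ((2 ^ m + (2 ^ m - 1)).+1 = 2 ^ m.+1)%N.
Proof. by rewrite -addnS -subSn ?expn_gt0 // subn1 /= addnn -mul2n -expnS. Qed.

(** All the counting of the induction, with no calculus: growth and monotonicity of the differences
    [G] on level sets of the gap of [F 0] are hypotheses. They are only asked for points with at
    least [R0] smaller points in the level set, since the analytic estimates may fail at the
    others. *)
Lemma growth_step m (R0 : nat) (C' : R) : 0 < C' -> exists2 C : R, 0 < C &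
  forall (A A0 : {fset R}) (nxt : R -> R) (F : nat -> R -> R),
  A != fset0 -> successor_on A A0 nxt ->
  (forall i, (i <= m.+1)%N -> {in A &, {homo F i : x y / x < y}}) ->
  (forall (d : R) X Y, 0 < d -> (X `<=` A0)%fset ->
    {in X, forall x, F 0%N (nxt x) - F 0%N x = d} -> (Y `<=` X)%fset ->
    {in Y, forall y, R0 <= #|` below X y|}%N ->
    let G i x := F i.+1 (nxt x) - F i.+1 x in
    (forall i, (i <= m)%N -> {in Y &, {homo G i : x y / x <= y}} \/
                             {in Y &, {homo G i : x y /~ x <= y}}) /\
    (Y != fset0 -> exists2 i, (i <= m)%N & C' * #|` Y|%:R `^ phi R m.+1
                          <= #|` sumdiff_between m (G i @` Y)%fset|%:R)) ->
  exists2 i, (i <= m.+1)%N & C * #|` A|%:R `^ phi R m.+2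
                     <= #|` sumdiff_between m.+1 (F i @` A)%fset|%:R.
Proof.
move=> C'0; set f := phi R m.+1; set f' := phi R m.+2.
have f0 : 0 < f := phi_gt0 m.
(* Once [u > u0], a level set with at least [u / 8] points has more than [4 * R0.+1], enough for
   [level_set_growth]. The constants [C1], [1 / 4] and [C2] serve the cases of bounded [N], of large
   growth of [F 0], and of growth of some [F i.+1]. *)
pose u0 : R := 32 * R0.+1%:R.
have u00 : 0 < u0 by rewrite mulr_gt0.
pose C1 : R := (u0 * (u0 `^ f) ^+ 2)^-1.
have C10 : 0 < C1 by rewrite invr_gt0 mulr_gt0 // exprn_gt0 // powR_gt0.
pose C2 : R := C' / (64 `^ f * 64 * m.+1%:R).
have C20 : 0 < C2 by rewrite divr_gt0 // !mulr_gt0 // powR_gt0.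
pose C := Num.min (1 / 4) (Num.min C1 C2).
have C0 : 0 < C by rewrite /C !lt_min C10 C20 divr_gt0.
have CC1 : C <= C1 by rewrite /C !ge_min lexx !orbT.
have CC2 : C <= C2 by rewrite /C !ge_min lexx !orbT.
have C4 : C <= 1 / 4 by rewrite /C !ge_min lexx.
exists C => // A A0 nxt F A_n0 [A0A cA0 nxtP nxt_le] Fmono H.
set N : R := #|` A|%:R.
have N1 : 1 <= N by rewrite ler1n cardfs_gt0.
have N0 : 0 < N by rewrite (lt_le_trans ltr01).
have [u [p [up pp upN ufp Nf]]] := @powR_phiS R m N N0.
rewrite -/f -/f' in ufp Nf; rewrite Nf.
(* If [u <= u0], then [N * p = u * p ^+ 2] is bounded and [C1] brings the required bound down to
   1. *)
have [uu0|u0u] := leP u u0.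
  exists 0%N => //.
  have p_le : p <= u0 `^ f by rewrite -ufp ge0_ler_powR // ?nnegrE ltW.
  have le1 : C * (N * p) <= 1.
    apply: (@le_trans _ _ (C1 * (u0 * (u0 `^ f) ^+ 2))).
      apply: ler_pM => //; rewrite ?mulr_ge0 ?(ltW C0) ?(ltW N0) ?(ltW pp) //.
      rewrite -upN -mulrA -expr2 ler_pM ?(ltW up) ?sqr_ge0 //.
      by rewrite lerXn2r ?nnegrE ?powR_ge0 // ltW.
    by rewrite mulVf // gt_eqF // mulr_gt0 // exprn_gt0 // powR_gt0.
  apply: le_trans le1 _; rewrite ler1n cardfs_gt0.
  have /fset0Pn[a aA] := A_n0; apply/fset0Pn; exists (F 0%N a).
  by apply: (fsubsetP (sub_sumdiff_between _ _)); rewrite in_imfset.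
have p1 : 1 <= p.
  have <- : 1 `^ f = 1 :> R by rewrite powR1.
  rewrite -ufp ge0_ler_powR ?nnegrE // ?ltW //.
  by apply: lt_trans u0u; rewrite /u0 (@lt_le_trans _ _ (32 * 1)) ?ler_pM2l ?ler1n //; lra.
pose dd a := F 0%N (nxt a) - F 0%N a.
have A0A' a : a \in A0 -> a \in A by apply: fsubsetP.
have Fle i : (i <= m.+1)%N -> {in A &, {homo F i : x y / x <= y}}.
  move=> im x y xA yA; rewrite le_eqVlt => /predU1P[->//|xy].
  exact/ltW/(Fmono i).
have dpos i a : (i <= m.+1)%N -> a \in A0 -> 0 < F i (nxt a) - F i a.
  move=> im aA; have [nA an] := nxtP a aA; rewrite subr_gt0; apply: Fmono => //.
  exact: A0A'.
pose D := (dd @` A0)%fset.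
(* The size of [k a] is the rank of the gap at [a] among all gap values. *)
pose k a := [fset d in D | d <= dd a]%fset.
have [bigF0|smallF0] := leP (N * p / 4)
    #|` sumdiff_between m.+1 (F 0%N @` A)%fset|%:R.
  exists 0%N => //; apply: le_trans bigF0; rewrite mulrC ler_pM2l ?mulr_gt0 //.
  by rewrite -div1r.
(* Adding the gaps in [k a] to [F 0 a] produces more than [p] elements for each point of [Bad]. As
   [F 0] grows little in this branch, [Bad] has fewer than [N / 4] points. *)
pose Bad := [fset a in A0 | p < #|` k a|%:R]%fset.
have sumk : (\sum_(a <- Bad) #|` k a| <= #|` sumdiff_between m.+1 (F 0%N @` A)%fset|)%N.
  apply: (@squeeze _ _ _ Bad nxt) => //.
  - by apply/fsubsetP => a; rewrite !inE => /andP[/A0A'].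
  - by move=> a; rewrite !inE => /andP[/nxtP[]].
  - by move=> a b; rewrite !inE => /andP[aA0 _]; exact: nxt_le.
  - exact: Fle.
  move=> a; rewrite !inE => /andP[aA0 _] e; rewrite !inE /= => /andP[eD ed].
  have e0 : 0 < e by move: eD => /imfsetP[a' a'A0 ->]; exact: dpos.
  split; first by rewrite e0.
  (* One added gap needs only two summands and one subtrahend; the rest is padding with [F 0 a]. *)
  have -> : (2 ^ m.+1 - 1 = 1 + (2 ^ m.+1 - 2))%N.
    by rewrite addnC -subnA // expnS leq_pmulr ?expn_gt0.
  have {1}-> : (2 ^ m.+1 = 2 + (2 ^ m.+1 - 2))%N.
    by rewrite subnKC // expnS leq_pmulr ?expn_gt0.
  apply: (@sumdiff_pad _ _ _ _ _ (F 0%N a)); first by rewrite in_imfset //= A0A'.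
  apply: (@sumdiff_differences _ 1 0 _ D); rewrite ?sumdiff10 //.
    move=> _ /imfsetP[a' a'A0 ->]; exists (F 0%N (nxt a')), (F 0%N a').
    by rewrite !in_imfset //= ?(nxtP _ _).1 ?A0A'.
  by rewrite in_imfset //= A0A'.
have badN : #|` Bad|%:R < N / 4.
  rewrite -(ltr_pM2r pp) mulrAC; apply: le_lt_trans smallF0.
  have := @card_mul_le_sum Bad p (fun a => #|` k a|).
  have Bp : {in Bad, forall a, p <= #|` k a|%:R} by move=> a; rewrite !inE => /andP[_ /ltW].
  by move=> /(_ Bp) /le_trans; apply; rewrite ler_nat.
pose G := [fset a in A0 | #|` k a|%:R <= p]%fset.
have GN : N / 4 <= #|` G|%:R.
  have : (#|` A| <= (#|` G| + #|` Bad|).+1)%N.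
    apply: leq_trans cA0 _; rewrite ltnS.
    apply: (@leq_trans #|` (G `|` Bad)%fset|); last by rewrite cardfsU leq_subr.
    apply/fsubset_leq_card/fsubsetP => a aA0; rewrite !inE aA0 /=.
    by case: leP.
  rewrite -(ler_nat R) -addn1 !natrD -/N => AN.
  have : 32 <= N.
    rewrite -upN -[32]mulr1 ler_pM //; apply: ltW; apply: le_lt_trans u0u.
    by rewrite /u0 ler_peMr // ler1n.
  by move: AN badN; clear; lra.
pose DG := (dd @` G)%fset.
(* The largest value in [DG] is the gap of a point of [G], so its rank is at most [p], and that rank
   counts all of [DG]. *)
have DGp : #|` DG|%:R <= p.
  have [DG0|DGn] := eqVneq (enum_fset DG) [::]; first by rewrite DG0 (le_trans ler01).
  have [_ /imfsetP[/= a aG ->] amax] := ex_max_seq DGn.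
  move: (aG); rewrite !inE => /andP[aA0 kp]; apply: le_trans kp; rewrite ler_nat.
  apply/fsubset_leq_card/fsubsetP => d dG; rewrite !inE /= amax // andbT.
  move: dG => /imfsetP[/= b]; rewrite !inE => /andP[bA0 _] ->.
  by rewrite in_imfset.
pose X d := [fset a in A0 | dd a == d]%fset.
(* There are at most [p] values in [DG], so those that are not [good] account for at most
   [p * (u / 8) = N / 8] points. *)
pose good d := u <= 8 * #|` X d|%:R.
have goodP d : good d -> [/\ (R0 <= #|` X d| %/ 4)%N, (0 < #|` X d| %/ 4)%N,
    (#|` X d| <= 8 * (#|` X d| %/ 4))%N & (4 * (#|` X d| %/ 4) <= #|` X d|)%N].
  move=> gd; have : (4 * R0.+1 < #|` X d|)%N.
    rewrite -(ltr_nat R) natrM -(ltr_pM2l (_ : 0 < 8 :> R)) //.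
    apply: lt_le_trans gd; rewrite mulrA -natrM; exact: u0u.
  exact: quarter_bounds.
pose G' i x := F i.+1 (nxt x) - F i.+1 x.
pose P d (w : nat * {fset R} * {fset R}) := let: (i, T, E) := w in
    [/\ (i <= m)%N, (T `<=` X d)%fset, (#|` X d| %/ 4 <= #|` T|)%N,
        (E `<=` sumdiff (2 ^ m) (2 ^ m - 1) (G' i @` X d)%fset)%fset
      & C' * (#|` X d| %/ 4)%:R `^ f <= #|` E|%:R /\
        {in T & E, forall a e, e <= G' i a /\ exists2 x, x \in X d & G' i x <= e}].
(* For each good [d]: an index [i], the points [T] of an outer block, and the elements [E] to be
   added at them. Other values of [d] receive a dummy triple. *)
have /boolp.choice[W WP] : forall d : R, exists w, d \in DG -> good d -> P d w.
  move=> d.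
  have [dDG|] := boolP (d \in DG); last first.
    by move=> _; exists (0%N, fset0, fset0).
  have [gd|ngd] := boolP (good d); last by exists (0%N, fset0, fset0).
  have [h1 h2 _ h4] := goodP d gd.
  have d0 : 0 < d.
    move: dDG => /imfsetP[/= a]; rewrite !inE => /andP[aA0 _] ->; exact: dpos.
  have XA0 : (X d `<=` A0)%fset by apply/fsubsetP => a; rewrite !inE => /andP[].
  have Xd : {in X d, forall x, F 0%N (nxt x) - F 0%N x = d}.
    by move=> a; rewrite !inE => /andP[_ /eqP].
  have [w wP] := level_set_growth h1 h2 h4 (fun Y => H d (X d) Y d0 XA0 Xd).
  by exists w.
pose c d := (W d).1.1; pose T d := (W d).1.2; pose E d := (W d).2.
have {}WP d : d \in DG -> good d -> P d (c d, T d, E d).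
  by move=> dD gd; have := WP d dD gd; rewrite /c /T /E; case: (W d) => [[]].
pose Q := [fset a in A0 | [&& dd a \in DG, good (dd a) & a \in T (dd a)]]%fset.
(* [N / 4] is at most the size of [G], hence at most 8 times the size of [Q] plus [N / 8]. *)
have QN : N / 64 <= #|` Q|%:R.
  have leT : (\sum_(d <- [seq d <- DG | good d]) #|` T d| <= #|` Q|)%N.
    apply: sum_card_le; first by rewrite filter_uniq ?fset_uniq.
      move=> d; rewrite mem_filter => /andP[gd dDG].
      have [_ /fsubsetP TX _ _ _] := WP d dDG gd.
      apply/fsubsetP => a aT; have := TX a aT; rewrite !inE => /andP[aA0 /eqP ad].
      by rewrite aA0 ad gd aT dDG.
    move=> d d'; rewrite !mem_filter => /andP[gd dDG] /andP[gd' dDG'] a aT aT'.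
    have [_ /fsubsetP TX _ _ _] := WP d dDG gd.
    have [_ /fsubsetP TX' _ _ _] := WP d' dDG' gd'.
    have := TX a aT; rewrite !inE => /andP[_ /eqP <-].
    by have := TX' a aT'; rewrite !inE => /andP[_ /eqP <-].
  have leX : (#|` G| <= \sum_(d <- DG) #|` X d|)%N.
    apply: card_le_sum => a aG; exists (dd a); first by rewrite in_imfset.
    by move: aG; rewrite !inE => /andP[->]; rewrite eqxx.
  have leXg : (\sum_(d <- DG | good d) #|` X d| <= 8 * #|` Q|)%N.
    apply: leq_trans (leq_mul (leqnn 8) leT).
    rewrite big_distrr /= big_filter big_seq_cond [X in (_ <= X)%N]big_seq_cond.
    apply: leq_sum => d /andP[dDG gd]; have [_ _ h3 _] := goodP d gd.
    by apply: leq_trans h3 _; rewrite leq_mul2l; have [_ _ -> _ _] := WP d dDG gd.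
  have leXb : (\sum_(d <- DG | ~~ good d) #|` X d|)%:R <= N / 8.
    apply: (@le_trans _ _ (p * (u / 8))); last by rewrite mulrA (mulrC p) upN.
    rewrite natr_sum; apply: (@le_trans _ _ (\sum_(d <- DG) u / 8)).
      rewrite big_mkcond /=; apply: ler_sum => d _; rewrite /good -ltNge.
      case: ltP => h; last by rewrite divr_ge0 // ltW.
      by rewrite ler_pdivlMr // mulrC ltW.
    rewrite sumr_const_seq ler_wpM2r //.
    by rewrite divr_ge0 // ltW.
  move: leX; rewrite (bigID good) /= -(ler_nat R) natrD => leX.
  move: leXg; rewrite -(ler_nat R) natrM => leXg.
  by move: GN leX leXg leXb; clear; lra.
have cm : {in Q, forall a, (c (dd a) <= m)%N}.
  by move=> a; rewrite !inE => /and4P[_ dDG gd _]; case: (WP _ dDG gd).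
(* The index chosen depends on the gap value; keeping the most frequent one costs a factor
   [m.+1]. *)
have [i im Qi] := pigeonhole_fset cm.
pose Qc := [fset a in Q | c (dd a) == i]%fset; rewrite -/Qc in Qi.
exists i.+1 => //.
have sumE : (\sum_(a <- Qc) #|` E (dd a)| <= #|` sumdiff_between m.+1 (F i.+1 @` A)%fset|)%N.
  apply: (@squeeze _ _ _ Qc nxt) => //.
  - by apply/fsubsetP => a; rewrite !inE => /andP[/andP[/A0A']].
  - by move=> a; rewrite !inE => /andP[/andP[/nxtP[]]].
  - by move=> a b; rewrite !inE => /andP[/andP[aA0 _] _]; exact: nxt_le.
  - exact: Fle.
  move=> a; rewrite !inE => /andP[/and4P[aA0 dDG gd aT] /eqP ci] e eE.
  have [_ _ _ /fsubsetP ES [_ TE]] := WP _ dDG gd.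
  have [] := TE a e aT eE; rewrite ci => ea [x xX xe].
  have xA0 : x \in A0 by move: xX; rewrite !inE => /andP[].
  split; first by rewrite ea (lt_le_trans _ xe) // dpos.
  rewrite -double_pow2_pred [X in sumdiff _ X]subn1 /=.
  apply: (@sumdiff_differences _ _ _ _ (G' i @` X (dd a))%fset).
  - move=> v /imfsetP[/= y]; rewrite !inE => /andP[yA0 _] ->.
    have [nyA _] := nxtP y yA0.
    by exists (F i.+1 (nxt y)), (F i.+1 y); split; rewrite // in_imfset //= A0A'.
  - by rewrite in_imfset //= A0A'.
  - by rewrite -ci; exact: ES.
(* Here 64 is 8 times 8: one factor comes from [good], the other from the quarter of a level set
   rounded down. *)
have lowE : #|` Qc|%:R * (C' * (p / 64 `^ f)) <= (\sum_(a <- Qc) #|` E (dd a)|)%:R.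
  apply: card_mul_le_sum => a; rewrite !inE => /andP[/and4P[aA0 dDG gd aT] _].
  have [_ _ _ _ [le _]] := WP _ dDG gd; apply: le_trans le.
  have [_ _ h3 _] := goodP _ gd.
  rewrite ler_pM2l //.
  have -> : p / 64 `^ f = (u / 64) `^ f.
    have n64 : 64 `^ f != 0 by rewrite gt_eqF // powR_gt0.
    apply: (mulIf n64); rewrite divfK // -powRM ?divr_ge0 ?ltW //.
    by rewrite divfK // -ufp.
  rewrite ge0_ler_powR ?nnegrE ?(ltW f0) // ?divr_ge0 ?(ltW up) //.
  move: h3; rewrite -(ler_nat R) natrM => h3; move: gd h3; rewrite /good; clear.
  by lra.
apply: (@le_trans _ _ (#|` Qc|%:R * (C' * (p / 64 `^ f)))); last first.
  by apply: le_trans lowE _; rewrite ler_nat.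
have {Qi} : #|` Q|%:R <= m.+1%:R * #|` Qc|%:R :> R by rewrite -natrM ler_nat.
move=> /(le_trans QN) Qi.
have n64 : 64 `^ f != 0 by rewrite gt_eqF // powR_gt0.
have M0 : m.+1%:R != 0 :> R by rewrite pnatr_eq0.
apply: (@le_trans _ _ (C2 * (N * p))).
  by rewrite ler_wpM2r // mulr_ge0 // ltW.
have -> : C2 * (N * p) = (N / 64) * (C' * (p / 64 `^ f) / m.+1%:R).
  by rewrite /C2; move: M0 n64; move: (m.+1%:R) (64 `^ f) => M v M0 v0; field; apply/andP.
have -> : #|` Qc|%:R * (C' * (p / 64 `^ f)) =
    (m.+1%:R * #|` Qc|%:R) * (C' * (p / 64 `^ f) / m.+1%:R).
  by move: M0 n64; move: (m.+1%:R) (64 `^ f) => M v M0 v0; field; apply/andP.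
by rewrite ler_wpM2r // !mulr_ge0 ?invr_ge0 ?powR_ge0 // ltW.
Qed.

End Growth.

(** * Calculus of functions that behave like a monomial *)

Section PowerLike.
Set Implicit Arguments.
Unset Strict Implicit.
Context {R : realType}.
Implicit Types (K : set R) (e f h : R -> R) (c dl eps : R) (mu : int) (k : nat).

(* [e] behaves like [c x^mu] on [K], together with its first [k] derivatives
   and with relative error [dl]. *)
Fixpoint power_like k K dl c mu e : Prop :=
  (forall x, K x -> `|e x - c * x ^ mu| <= dl * x ^ mu) /\
  if k is k'.+1 then exists2 e', (forall x, K x -> is_derive x 1 e (e' x)) &
    power_like k' K dl (c * mu%:~R) (mu - 1) e'
  else True.

Definition positive_set K := forall x, K x -> 0 < x.

Lemma power_like_val k K dl c mu e : power_like k K dl c mu e ->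
  forall x, K x -> `|e x - c * x ^ mu| <= dl * x ^ mu.
Proof. by case: k => [|k] []. Qed.

Lemma power_likeS k K dl c mu e : power_like k.+1 K dl c mu e ->
  exists2 e', (forall x, K x -> is_derive x 1 e (e' x)) &
    power_like k K dl (c * mu%:~R) (mu - 1) e'.
Proof. by case. Qed.

Lemma power_like_weaken k k' K K' dl dl' c mu e : positive_set K ->
  (k' <= k)%N -> K' `<=` K -> dl <= dl' ->
  power_like k K dl c mu e -> power_like k' K' dl' c mu e.
Proof.
move=> K0 + KK' dd; elim: k k' c mu e => [|k IH] [|k'] c mu e //= kk [H1 H2]; split => //.
1-3: move=> x Kx; apply: le_trans (H1 _ (KK' _ Kx)) _.
1-3: by rewrite ler_wpM2r // ltW // exprz_gt0 // K0 //; exact: KK'.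
by case: H2 => e' de ae; exists e' => [x /KK'|]; [exact: de|exact: IH].
Qed.

Lemma power_likeD k K d1 d2 c1 c2 mu e1 e2 :
  power_like k K d1 c1 mu e1 -> power_like k K d2 c2 mu e2 ->
  power_like k K (d1 + d2) (c1 + c2) mu (fun x => e1 x + e2 x).
Proof.
elim: k c1 c2 mu e1 e2 => [|k IH] c1 c2 mu e1 e2 /= [H1 H2] [H3 H4]; split => //.
- move=> x Kx; rewrite 2!mulrDl opprD addrACA (le_trans (ler_normD _ _)) //.
  by rewrite lerD ?H1 ?H3.
- move=> x Kx; rewrite 2!mulrDl opprD addrACA (le_trans (ler_normD _ _)) //.
  by rewrite lerD ?H1 ?H3.
- case: H2 => e1' de1 ae1; case: H4 => e2' de2 ae2.
  exists (fun x => e1' x + e2' x) => [x Kx|]; last by rewrite mulrDl; exact: IH.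
  by apply: is_deriveD; [exact: de1|exact: de2].
Qed.

Lemma power_likeZ k K a dl c mu e :
  power_like k K dl c mu e ->
  power_like k K (`|a| * dl) (a * c) mu (fun x => a * e x).
Proof.
elim: k c mu e => [|k IH] c mu e /= [H1 H2]; split => //.
- by move=> x Kx; rewrite -!mulrA -mulrBr normrM ler_wpM2l ?H1.
- by move=> x Kx; rewrite -!mulrA -mulrBr normrM ler_wpM2l ?H1.
- case: H2 => e' de ae; exists (fun x => a * e' x) => [x Kx|]; last first.
    by rewrite -mulrA; exact: IH.
  exact: (@is_deriveZ _ _ _ e a x 1 (e' x) (de x Kx)).
Qed.

(** For [dl <= 1] the relative error of the product is at most [dl * (]|c1| + [|c2| + 1)], the last
    summand absorbing the quadratic term. *)
Lemma relative_error_mul c1 c2 eps : 0 < eps -> exists2 d0 : R, 0 < d0 &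
  forall dl X Y a b : R, dl <= d0 -> 0 < X -> 0 < Y ->
    `|a - c1 * X| <= dl * X -> `|b - c2 * Y| <= dl * Y ->
    `|a * b - c1 * c2 * (X * Y)| <= eps * (X * Y).
Proof.
move=> eps0; pose M := `|c1| + `|c2| + 1.
have M0 : 0 < M by rewrite ltr_wpDl ?addr_ge0.
exists (Num.min 1 (eps / M)); first by rewrite lt_min ltr01 divr_gt0.
move=> dl X Y a b ldl X0 Y0 ha hb.
have dl1 : dl <= 1 by apply: le_trans ldl _; rewrite ge_min lexx.
have dle : dl * M <= eps.
  by rewrite -ler_pdivlMr //; apply: le_trans ldl _; rewrite ge_min lexx orbT.
have -> : a * b - c1 * c2 * (X * Y) = (a - c1 * X) * (b - c2 * Y)
    + (a - c1 * X) * (c2 * Y) + c1 * X * (b - c2 * Y) by ring.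
have dl0 : 0 <= dl by rewrite -(pmulr_lge0 _ X0) (le_trans _ ha).
have t1 : `|(a - c1 * X) * (b - c2 * Y)| <= dl * (X * Y).
  rewrite normrM; apply: (@le_trans _ _ ((dl * X) * (dl * Y))); first exact: ler_pM.
  by rewrite mulrACA ler_wpM2r ?mulr_ge0 ?(ltW X0) ?(ltW Y0) // ler_piMl.
have t2 : `|(a - c1 * X) * (c2 * Y)| <= dl * `|c2| * (X * Y).
  rewrite !normrM (gtr0_norm Y0) (_ : dl * _ * _ = dl * X * (`|c2| * Y)); last by ring.
  by rewrite ler_wpM2r ?mulr_ge0 ?(ltW Y0).
have t3 : `|c1 * X * (b - c2 * Y)| <= dl * `|c1| * (X * Y).
  rewrite !normrM (gtr0_norm X0) (_ : dl * _ * _ = `|c1| * X * (dl * Y)); last by ring.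
  by rewrite ler_wpM2l ?mulr_ge0 ?(ltW X0).
apply: le_trans (ler_normD _ _) _; apply: le_trans (lerD (ler_normD _ _) t3) _.
apply: le_trans (lerD (lerD t1 t2) (lexx _)) _.
apply: (@le_trans _ _ (dl * M * (X * Y))).
  by rewrite le_eqVlt; apply/orP; left; apply/eqP; rewrite /M; ring.
by rewrite ler_wpM2r ?mulr_ge0 ?(ltW X0) ?(ltW Y0).
Qed.

Lemma relative_error_inv c eps : c != 0 -> 0 < eps -> exists2 d0 : R, 0 < d0 &
  forall dl X a : R, dl <= d0 -> 0 < X -> `|a - c * X| <= dl * X ->
    a != 0 /\ `|a^-1 - c^-1 * X^-1| <= eps * X^-1.
Proof.
move=> c0 eps0; have nc0 : 0 < `|c| by rewrite normr_gt0.
exists (Num.min (`|c| / 2) (eps * `|c| ^+ 2 / 2)).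
  by rewrite lt_min !divr_gt0 // mulr_gt0 // exprn_gt0.
move=> dl X a; rewrite le_min => /andP[dl1 dl2] X0 ha.
have aX : `|c| / 2 * X <= `|a|.
  have : `|c * X| <= `|c * X - a| + `|a| by rewrite -{1}(subrK a (c * X)) ler_normD.
  rewrite normrM (gtr0_norm X0) distrC.
  have : dl * X <= `|c| / 2 * X by rewrite ler_wpM2r // ltW.
  by move: ha; clear; lra.
have a0 : a != 0 by rewrite -normr_gt0 (lt_le_trans _ aX) // mulr_gt0 // divr_gt0.
split=> //; have X0' : X != 0 by rewrite gt_eqF.
have -> : a^-1 - c^-1 * X^-1 = (c * X - a) / (a * (c * X)).
  by field; rewrite X0' c0 a0.
rewrite normrM normfV distrC ler_pdivrMr ?normr_gt0 ?mulf_neq0 //.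
apply: le_trans ha _; rewrite !normrM (gtr0_norm X0).
have -> : eps * X^-1 * (`|a| * (`|c| * X)) = eps * `|a| * `|c| by field.
apply: (@le_trans _ _ (eps * `|c| ^+ 2 / 2 * X)).
  by rewrite ler_wpM2r // ltW.
apply: (@le_trans _ _ (eps * (`|c| / 2 * X) * `|c|)).
  by rewrite le_eqVlt; apply/orP; left; apply/eqP; field.
by rewrite ler_wpM2r ?(ltW nc0) // ler_wpM2l // ltW.
Qed.

(** Leibniz rule: the two terms of the derivative have the same exponent, and their coefficients add
    up to [c1 * c2 * (mu1 + mu2)]. The tolerance is chosen before the set and the functions, which
    gives the uniformity needed later. *)
Lemma power_like_mul k c1 c2 (mu1 mu2 : int) eps : 0 < eps ->
  exists2 dl, 0 < dl & forall K e1 e2, positive_set K ->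
    power_like k K dl c1 mu1 e1 -> power_like k K dl c2 mu2 e2 ->
    power_like k K eps (c1 * c2) (mu1 + mu2) (fun x => e1 x * e2 x).
Proof.
elim: k c1 c2 mu1 mu2 eps => [|k IH] c1 c2 mu1 mu2 eps eps0;
  have [d0 d00 val] := relative_error_mul c1 c2 eps0.
  exists d0 => // K e1 e2 K0 [H1 _] [H2 _]; split => // x Kx; have x0 := K0 x Kx.
  rewrite expfzDr ?gt_eqF //.
  by apply: val (H1 x Kx) (H2 x Kx); rewrite ?exprz_gt0.
have e20 : 0 < eps / 2 by rewrite divr_gt0.
have [d1 d10 P1] := IH (c1 * mu1%:~R) c2 (mu1 - 1) mu2 _ e20.
have [d2 d20 P2] := IH c1 (c2 * mu2%:~R) mu1 (mu2 - 1) _ e20.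
exists (Num.min d0 (Num.min d1 d2)); first by rewrite !lt_min d00 d10.
move=> K e1 e2 K0 A1 A2; have l1 : Num.min d0 (Num.min d1 d2) <= d1.
  by rewrite !ge_min lexx orbT.
have l2 : Num.min d0 (Num.min d1 d2) <= d2 by rewrite !ge_min lexx !orbT.
have l0 : Num.min d0 (Num.min d1 d2) <= d0 by rewrite !ge_min lexx.
case: (A1) => H1 [e1' de1 ae1]; case: (A2) => H2 [e2' de2 ae2]; split.
  move=> x Kx; have x0 := K0 x Kx; rewrite expfzDr ?gt_eqF //.
  by apply: val (H1 x Kx) (H2 x Kx); rewrite ?exprz_gt0.
exists (fun x => e1' x * e2 x + e1 x * e2' x) => [x Kx|].
  apply: is_derive_eq (is_deriveM (de1 x Kx) (de2 x Kx)) _.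
  by rewrite /GRing.scale /=; ring.
have -> : c1 * c2 * (mu1 + mu2)%:~R = c1 * mu1%:~R * c2 + c1 * (c2 * mu2%:~R).
  by rewrite intrD; ring.
rewrite (splitr eps); apply: power_likeD.
  have -> : (mu1 + mu2 - 1 = mu1 - 1 + mu2)%R by rewrite addrAC.
  apply: P1 => //; first exact: power_like_weaken ae1.
  exact: power_like_weaken A2.
rewrite -addrA; apply: P2 => //; last exact: power_like_weaken ae2.
exact: power_like_weaken A1.
Qed.

Lemma power_like_inv k c mu eps : c != 0 -> 0 < eps ->
  exists2 dl, 0 < dl & forall K e, positive_set K -> power_like k K dl c mu e ->
    (forall x, K x -> e x != 0) /\
    power_like k K eps c^-1 (- mu) (fun x => (e x)^-1).
Proof.
move=> c0; elim: k eps => [|k IH] eps eps0;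
  have [d0 d00 val] := relative_error_inv c0 eps0.
  exists d0 => // K e K0 [H _].
  have V x : K x -> e x != 0 /\ `|(e x)^-1 - c^-1 * (x ^ mu)^-1| <= eps * (x ^ mu)^-1.
    by move=> Kx; apply: val (H x Kx); rewrite ?exprz_gt0 ?K0.
  by split=> [x /V[]//|]; split=> // x /V[_]; rewrite invr_expz.
(* The derivative of the inverse is [- e'] times the square of the inverse. Tolerances are fixed
   backwards: [d1] for this product, [d2] for the square, [d3] for the inverse itself with one
   derivative fewer. *)
have [d1 d10 P1] := @power_like_mul k (- (c * mu%:~R)) (c^-1 * c^-1) (mu - 1) (- mu - mu) eps eps0.
have [d2 d20 P2] := @power_like_mul k c^-1 c^-1 (- mu) (- mu) d1 d10.
have [d3 d30 P3] := IH d2 d20.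
pose d := Num.min d0 (Num.min d1 d3); exists d; first by rewrite !lt_min d00 d10.
have l1 : d <= d1 by rewrite !ge_min lexx orbT.
have l3 : d <= d3 by rewrite !ge_min lexx !orbT.
have l0 : d <= d0 by rewrite !ge_min lexx.
move=> K e K0 A; case: (A) => H [e' de ae].
have V x : K x -> e x != 0 /\ `|(e x)^-1 - c^-1 * (x ^ mu)^-1| <= eps * (x ^ mu)^-1.
  by move=> Kx; apply: val (H x Kx); rewrite ?exprz_gt0 ?K0.
split=> [x /V[]//|]; split=> [x /V[_]|]; first by rewrite invr_expz.
exists (fun x => -1 * e' x * ((e x)^-1 * (e x)^-1)) => [x Kx|].
  apply: is_derive_eq (is_deriveV (V x Kx).1 (de x Kx)) _.
  by rewrite /GRing.scale /= expr2 invfM; ring.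
have -> : c^-1 * (- mu)%:~R = - (c * mu%:~R) * (c^-1 * c^-1).
  by rewrite mulrNz; field.
have -> : (- mu - 1 = mu - 1 + (- mu - mu))%R by ring.
apply: P1 => //.
  have {}ae : power_like k K d1 (c * mu%:~R) (mu - 1) e' by exact: power_like_weaken ae.
  by have := power_likeZ (-1) ae; rewrite normrN1 mul1r mulN1r.
have [|_ P3e] := P3 K e K0; first exact: power_like_weaken A.
exact: P2.
Qed.

End PowerLike.

(** * Difference quotients along a shift *)

Section Difference.
Set Implicit Arguments.
Unset Strict Implicit.
Context {R : realType}.
Implicit Types (K : set R) (e f h : R -> R) (c dl eps : R) (mu : int) (k m : nat).

Lemma derive_within_continuous K f f' x y : is_interval K ->
  (forall z, K z -> is_derive z 1 f (f' z)) -> K x -> K y ->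
  {within `[x, y], continuous f}.
Proof.
move=> iK df Kx Ky; apply: derivable_within_continuous => z.
by rewrite in_itv /= => zxy; have [] := df z (iK x y Kx Ky z zxy).
Qed.

Lemma interval_oo K x y z : is_interval K -> K x -> K y -> z \in `]x, y[ -> K z.
Proof.
move=> iK Kx Ky; rewrite in_itv /= => /andP[xz zy].
by apply: (iK x y) => //; rewrite !ltW.
Qed.

Lemma MVT_on K f f' x y : is_interval K ->
  (forall z, K z -> is_derive z 1 f (f' z)) -> K x -> K y -> x < y ->
  exists2 z, x < z < y & f y - f x = f' z * (y - x).
Proof.
move=> iK df Kx Ky xy.
have df' z : z \in `]x, y[ -> is_derive z 1 f (f' z).
  by move=> zxy; exact/df/(interval_oo iK Kx Ky).
have [z zxy E] := MVT xy df' (derive_within_continuous iK df Kx Ky).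
by exists z; move: zxy; rewrite ?in_itv.
Qed.

Lemma derive_pos_increasing K f f' : is_interval K ->
  (forall z, K z -> is_derive z 1 f (f' z)) -> (forall z, K z -> 0 < f' z) ->
  forall x y, K x -> K y -> x < y -> f x < f y.
Proof.
move=> iK df f'0 x y Kx Ky xy; have [z zxy E] := MVT_on iK df Kx Ky xy.
rewrite -subr_gt0 E mulr_gt0 ?subr_gt0 // f'0 //.
by apply: (interval_oo iK Kx Ky); rewrite in_itv.
Qed.

(** By homogeneity only the ratio [y / x] matters, and [t ^ nu] is continuous at 1; hence [eta] does
    not depend on [x]. *)
Lemma exprz_close (nu : int) eps : 0 < eps -> exists2 eta : R, 0 < eta &
  forall x y : R, 0 < x -> x <= y <= (1 + eta) * x -> `|y ^ nu - x ^ nu| <= eps * x ^ nu.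
Proof.
move=> eps0.
have cont : {for 1, continuous (fun t : R => t ^ nu)}.
  case: nu => n; first exact: exprn_continuous.
  apply: cvgV; first by rewrite expr1n oner_neq0.
  exact: exprn_continuous.
have /cvgrPdist_le /(_ eps eps0) := cont.
rewrite -nbhs_nearE => /nbhs_ballP[eta /= eta0 H].
exists (eta / 2) => [|x y x0 /andP[xy yx]]; first by rewrite divr_gt0.
have x0' : x != 0 by rewrite gt_eqF.
have [r yr] : exists r, y = r * x by exists (y / x); rewrite divfK.
have r1 : 1 <= r by rewrite -(ler_pM2r x0) mul1r -yr.
have r2 : r <= 1 + eta / 2 by rewrite -(ler_pM2r x0) -yr.
rewrite yr expfzMl -[X in _ - X]mul1r -mulrBl normrM.
rewrite (gtr0_norm (exprz_gt0 nu x0)) ler_wpM2r //; first by rewrite ltW // exprz_gt0.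
rewrite distrC; have := H r; rewrite exp1rz; apply.
rewrite /ball /= distrC ger0_norm ?subr_ge0 //; move: eta0 r2; clear; lra.
Qed.

(** By the Cauchy mean value theorem and [f0 (s x) - f0 x = d], the quotient equals [h' z / e0 z]
    for some [z] between [x] and [s x], where [z ^ nu] is close to [x ^ nu]. *)
Lemma diff_quotient_close c1 (nu : int) eps : 0 < eps -> exists2 eta : R, 0 < eta &
  forall K K' f0 e0 s d h h' dl, positive_set K -> is_interval K -> K' `<=` K ->
  (forall x, K x -> is_derive x 1 f0 (e0 x)) ->
  (forall x, K x -> is_derive x 1 h (h' x)) -> (forall x, K x -> e0 x != 0) ->
  (forall x, K x -> `|h' x / e0 x - c1 * x ^ nu| <= eps / 4 * x ^ nu) -> dl <= eta ->
  (forall x, K' x -> [/\ K (s x), x < s x <= (1 + dl) * x & f0 (s x) = f0 x + d]) ->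
  forall x, K' x -> `|(h (s x) - h x) / d - c1 * x ^ nu| <= eps * x ^ nu.
Proof.
move=> eps0; have M0 : 0 < `|c1| + 1 by rewrite ltr_wpDl.
(* [e2 <= 1] gives [z ^ nu <= 2 * x ^ nu], so the error [eps / 4] at [z] costs at most [eps / 2] at
   [x]; the other half pays for replacing [z ^ nu] by [x ^ nu]. *)
pose e2 := Num.min 1 (eps / 2 / (`|c1| + 1)).
have e20 : 0 < e2 by rewrite lt_min ltr01 !divr_gt0.
have e40 : 0 < eps / 4 by rewrite divr_gt0.
have [eta eta0 close] := exprz_close nu e20; exists eta => //.
move=> K K' f0 e0 s d h h' dl K0 iK KK' df0 dh e00 gP ldl sP x K'x.
have Kx := KK' _ K'x; have [Ksx /andP[xsx sxx] fsx] := sP x K'x.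
have x0 := K0 x Kx.
have Kxs z : z \in `]x, s x[ -> K z := interval_oo iK Kx Ksx.
have [z zx E] := cauchy_MVT xsx
  (derive_within_continuous iK dh Kx Ksx) (derive_within_continuous iK df0 Kx Ksx)
  (fun z zx => dh z (Kxs z zx)) (fun z zx => df0 z (Kxs z zx))
  (fun z zx => e00 z (Kxs z zx)).
have {E} -> : (h (s x) - h x) / d = h' z / e0 z by rewrite E fsx addrAC subrr add0r.
have Kz : K z := interval_oo iK Kx Ksx zx.
move: zx; rewrite in_itv /= => /andP[xz zsx].
have /(close x z x0) cl : x <= z <= (1 + eta) * x.
  rewrite ltW //= (le_trans (ltW zsx)) // (le_trans sxx) // ler_wpM2r ?(ltW x0) //.
  by rewrite lerD2l.
have X0 := exprz_gt0 nu x0.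
have := gP z Kz; move: cl X0; move: (z ^ nu) (x ^ nu) (h' z / e0 z) => Z X g.
move=> cl X0 gZ.
have e21 : e2 <= 1 by rewrite /e2 ge_min lexx.
have e2c : `|c1| * e2 <= eps / 2.
  apply: (@le_trans _ _ ((`|c1| + 1) * e2)); first by rewrite ler_wpM2r ?(ltW e20) // lerDl.
  by rewrite mulrC -ler_pdivlMr // /e2 ge_min lexx orbT.
have ZX : Z <= 2 * X.
  have := ler_norm (Z - X); have : e2 * X <= 1 * X by rewrite ler_wpM2r // ltW.
  by move: cl; clear; lra.
have -> : g - c1 * X = (g - c1 * Z) + c1 * (Z - X) by ring.
apply: le_trans (ler_normD _ _) _; rewrite normrM.
have t1 : eps / 4 * Z <= eps / 4 * (2 * X) by rewrite ler_wpM2l // ltW.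
have t2 : `|c1| * `|Z - X| <= `|c1| * (e2 * X) by rewrite ler_wpM2l.
have t3 : `|c1| * (e2 * X) <= eps / 2 * X by rewrite mulrA ler_wpM2r // ltW.
by move: gZ t1 t2 t3; clear; lra.
Qed.

(** Since [s] has derivative [e0 x / e0 (s x)], the derivative of the quotient is [e0 x] times the
    same kind of quotient for [h' / e0]. Thus the induction on [k] closes, consuming one derivative
    of [h]. *)
Lemma power_like_diff k c0 (mu0 : int) c mu eps : c0 != 0 -> 0 < eps ->
  exists2 dl, 0 < dl & forall K K' f0 e0 s d h,
    positive_set K -> is_interval K -> K' `<=` K ->
    (forall x, K x -> is_derive x 1 f0 (e0 x)) ->
    power_like k K dl c0 mu0 e0 ->
    (forall x, K' x -> [/\ K (s x), x < s x <= (1 + dl) * x, f0 (s x) = f0 x + d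
                        & is_derive x 1 s (e0 x / e0 (s x))]) ->
    power_like k.+1 K dl c mu h ->
    power_like k K' eps (c * mu%:~R / c0) (mu - 1 - mu0)
      (fun x => (h (s x) - h x) / d).
Proof.
move=> c00; elim: k c mu eps => [|k IH] c mu eps eps0;
  have e40 : 0 < eps / 4 by rewrite divr_gt0.
  have [eta eta0 val] := diff_quotient_close (c * mu%:~R / c0) (mu - 1 - mu0) eps0.
  have [d1 d10 P1] := @power_like_mul _ 0 (c * mu%:~R) c0^-1 (mu - 1) (- mu0) _ e40.
  have [d2 d20 P2] := @power_like_inv _ 0 c0 mu0 _ c00 d10.
  pose dl := Num.min eta (Num.min d1 d2); exists dl; first by rewrite !lt_min eta0 d10.
  have l1 : dl <= eta by rewrite ge_min lexx.
  have l2 : dl <= d1 by rewrite !ge_min lexx orbT.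
  have l3 : dl <= d2 by rewrite !ge_min lexx !orbT.
  move=> K K' f0 e0 s d h K0 iK KK' df0 ae0 sP /power_likeS[h' dh ah].
  have [|e00 ie0] := P2 K e0 K0; first exact: power_like_weaken ae0.
  split => //; apply: (val K K' f0 e0 s d h h' dl) => //; last by move=> x /sP[].
  have ah' : power_like 0 K d1 (c * mu%:~R) (mu - 1) h' by exact: power_like_weaken ah.
  by have [] := P1 K _ _ K0 ah' ie0.
pose c1 := c * mu%:~R / c0; pose nu := mu - 1 - mu0.
have [eta eta0 val] := diff_quotient_close c1 nu eps0.
have [d4 d40 P4] := @power_like_mul _ k c0 (c1 * nu%:~R / c0) mu0 (nu - 1 - mu0) _ eps0.
have [d3 d30 P3] := IH c1 nu d4 d40.
have d50 : 0 < Num.min (eps / 4) d3 by rewrite lt_min e40.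
have [d1 d10 P1] := @power_like_mul _ k.+1 (c * mu%:~R) c0^-1 (mu - 1) (- mu0) _ d50.
have [d2 d20 P2] := @power_like_inv _ k.+1 c0 mu0 _ c00 d10.
pose dl := Num.min eta (Num.min d1 (Num.min d2 (Num.min d3 d4))).
exists dl; first by rewrite !lt_min eta0 d10 d20 d30.
have l1 : dl <= eta by rewrite ge_min lexx.
have l2 : dl <= d1 by rewrite !ge_min lexx orbT.
have l3 : dl <= d2 by rewrite !ge_min lexx !orbT.
have l4 : dl <= d3 by rewrite !ge_min lexx !orbT.
have l5 : dl <= d4 by rewrite !ge_min lexx !orbT.
move=> K K' f0 e0 s d h K0 iK KK' df0 ae0 sP /power_likeS[h' dh ah].
have [|e00 ie0] := P2 K e0 K0; first exact: power_like_weaken ae0.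
have ag : power_like k.+1 K (Num.min (eps / 4) d3) c1 nu (fun x => h' x / e0 x).
  by apply: P1 => //; exact: power_like_weaken ah.
split => //.
  apply: (val K K' f0 e0 s d h h' dl) => //; last by move=> x /sP[].
  apply: (@power_like_val _ k.+1).
  by apply: power_like_weaken ag => //; rewrite ge_min lexx.
exists (fun x => e0 x * ((h' (s x) / e0 (s x) - h' x / e0 x) / d)) => [x K'x|].
  have Kx := KK' x K'x; have [Ks _ _ ds] := sP x K'x.
  have dhs := is_derive1_comp (dh (s x) Ks) ds.
  have := is_deriveZ d^-1 (is_deriveB dhs (dh x Kx)).
  rewrite (_ : _ \*: _ = (fun x => (h (s x) - h x) / d)); last first.
    by apply/funext => y; rewrite /= /GRing.scale /= mulrC.
  move=> D; apply: is_derive_eq D _; rewrite /GRing.scale /=.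
  have [n0 ns0] := (e00 x Kx, e00 _ Ks).
  rewrite mulrC [RHS]mulrA; congr (_ / d).
  by field; rewrite n0 ns0.
have -> : c * mu%:~R / c0 * (mu - 1 - mu0)%:~R = c0 * (c1 * nu%:~R / c0).
  by rewrite /c1 /nu; field.
have -> : (mu - 1 - mu0 - 1 = mu0 + (nu - 1 - mu0))%R by rewrite /nu; ring.
apply: P4; [by move=> x /KK' /K0|exact: power_like_weaken ae0|].
apply: (P3 K K' f0 e0 s d (fun x => h' x / e0 x)) => //.
- exact: power_like_weaken ae0.
- move=> x K'x; have [Ks /andP[xs sx] fs ds] := sP x K'x; split => //.
  by rewrite xs (le_trans sx) // ler_wpM2r ?lerD2l // ltW // K0 //; exact: KK'.
- by apply: power_like_weaken ag => //; rewrite ge_min lexx orbT.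
Qed.

End Difference.

(** * The shift by a fixed gap, its size, and the sign of triangular combinations *)

Section Shift.
Set Implicit Arguments.
Unset Strict Implicit.
Context {R : realType}.
Implicit Types (K : set R) (e f : R -> R) (k m : nat).

Lemma is_derive_continuous f (x l : R) : is_derive x 1 f l -> {for x, continuous f}.
Proof. by case=> df _; apply/differentiable_continuous/derivable1_diffP. Qed.

Definition shift_dom K f (d : R) : set R := [set x | K x /\ exists2 y, K y & f y = f x + d].

(** The shift is the inverse of [f] applied to [f x + d]; its derivative follows from the inverse
    function rule. *)
Lemma shift_exists K f e (d : R) : open K -> is_interval K -> 0 < d ->
  (forall x, K x -> is_derive x 1 f (e x)) -> (forall x, K x -> 0 < e x) ->
  [/\ open (shift_dom K f d), is_interval (shift_dom K f d) &
  exists s : R -> R, forall x, shift_dom K f d x ->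
    [/\ K (s x), x < s x, f (s x) = f x + d & is_derive x 1 s (e x / e (s x))]].
Proof.
move=> oK iK d0 df e0.
have inc := derive_pos_increasing iK df e0.
have inj x y : K x -> K y -> f x = f y -> x = y.
  move=> Kx Ky fxy; have [xy|yx|//] := ltgtP x y.
    by have := inc x y Kx Ky xy; rewrite fxy ltxx.
  by have := inc y x Ky Kx yx; rewrite fxy ltxx.
have lt_of x y : K x -> K y -> f x < f y -> x < y.
  move=> Kx Ky fxy; have [//|yx|xy] := ltgtP x y; last by move: fxy; rewrite xy ltxx.
  by have := lt_trans fxy (inc y x Ky Kx yx); rewrite ltxx.
have ivt x y (v : R) : K x -> K y -> f x <= v <= f y -> exists2 z, K z & f z = v.
  move=> Kx Ky /andP[xv vy].
  have xy : x <= y.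
    rewrite leNgt; apply/negP => yx.
    by have := inc y x Ky Kx yx; rewrite ltNge (le_trans xv vy).
  have [|z] := IVT xy (derive_within_continuous iK df Kx Ky) (v := v).
    by rewrite (le_trans _ xv) ?ge_min ?lexx // (le_trans vy) // le_max lexx orbT.
  by rewrite in_itv /= => zxy fz; exists z => //; exact: (iK x y).
split.
- rewrite openE => x [Kx [y Ky fy]].
  have /nbhs_ballP[r /= r0 yr] : nbhs y K by apply: open_nbhs_nbhs.
  (* Room above [y]: for [z] near [x] the value [f z + d] stays below [f (y + r / 2)], so it is
     attained on [K]. *)
  have Ky' : K (y + r / 2).
    apply: yr; rewrite /ball /= opprD addrA subrr add0r normrN gtr0_norm ?divr_gt0 //.
    by move: r0; clear; lra.
  have yy' : f y < f (y + r / 2) by apply: inc => //; rewrite ltrDl divr_gt0.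
  have /cvgrPdist_lt /(_ (f (y + r / 2) - f y)) := is_derive_continuous (df x Kx).
  rewrite subr_gt0 => /(_ yy') near1; rewrite /interior /=.
  have near2 : nbhs x K by apply: open_nbhs_nbhs.
  near=> z; have Kz : K z by near: z.
  split => //; apply: (ivt z (y + r / 2)) => //.
  have : `|f x - f z| < f (y + r / 2) - f y by near: z.
  rewrite ltr_norml lerDl (ltW d0) /= => /andP[].
  by move: fy; clear; lra.
- move=> x y [Kx [x' Kx' fx']] [Ky [y' Ky' fy']] z xzy.
  have Kz := iK x y Kx Ky z xzy; split => //; apply: (ivt x' y') => //.
  have mono u v : K u -> K v -> u <= v -> f u <= f v.
    by move=> Ku Kv; rewrite le_eqVlt => /predU1P[->//|/(inc u v Ku Kv)/ltW].
  case/andP: xzy => /(mono x z Kx Kz) h1 /(mono z y Kz Ky) h2.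
  by rewrite fx' fy' !lerD2r h1.
(* A global inverse of [f], with an arbitrary value off the range. *)
have /boolp.choice[g gP] : forall v : R, exists y, (exists2 z, K z & f z = v) -> K y /\ f y = v.
  move=> v; have [[z Kz fz]|no] := pselect (exists2 z, K z & f z = v); first by exists z.
  by exists 0.
have gK y : K y -> g (f y) = y.
  by move=> Ky; have [|Kg fg] := gP (f y); [exists y|exact: inj].
exists (fun x => g (f x + d)) => x [Kx [y Ky fy]].
rewrite -fy gK //; split => //; first by apply: lt_of; rewrite // fy ltrDl.
have dg : is_derive (f y) 1 g (e y)^-1.
  apply: (is_derive_inverse _ _ (df y Ky)); last by rewrite gt_eqF // e0.
    near=> z; apply: gK; near: z; exact: open_nbhs_nbhs.
  near=> z; apply: (@is_derive_continuous f z (e z)); apply: df; near: z.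
  exact: open_nbhs_nbhs.
have dfd : is_derive x 1 (f + cst d) (e x).
  by apply: is_derive_eq (is_deriveD (df x Kx) (is_derive_cst d x 1)) _; rewrite addr0.
rewrite fy in dg; rewrite mulrC; exact: (@is_derive1_comp _ g (f + cst d) x _ _ dg dfd).
Unshelve. all: by end_near.
Qed.

(** Otherwise [f] would already gain at least [c * x ^+ mu0 * (dl * x)], which exceeds [d], on the
    way from [x] to [(1 + dl) * x]. *)
Lemma shift_close K f e (mu0 : nat) (c dl d x y : R) : is_interval K -> positive_set K ->
  (forall x, K x -> is_derive x 1 f (e x)) -> 0 < c ->
  (forall x, K x -> c * x ^+ mu0 <= e x) -> 0 < dl -> K x -> K y ->
  f y = f x + d -> d < c * dl * x ^+ mu0.+1 -> y <= (1 + dl) * x.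
Proof.
move=> iK K0 df c0 ce dl0 Kx Ky fy dx; have x0 := K0 x Kx.
rewrite leNgt; apply/negP => xy; set z := (1 + dl) * x in xy.
have xz : x < z by rewrite /z ltr_pMl // ltrDl.
have Kz : K z by apply: (iK x y) => //; rewrite !ltW.
have e0 u : K u -> 0 < e u.
  by move=> Ku; rewrite (lt_le_trans _ (ce u Ku)) // mulr_gt0 // exprn_gt0 // K0.
have inc := derive_pos_increasing iK df e0.
have fzy := inc z y Kz Ky xy.
have [t /andP[xt tz] E] := MVT_on iK df Kx Kz xz.
have Kt : K t by apply: (iK x z) => //; rewrite !ltW.
have et : c * x ^+ mu0 <= e t.
  apply: le_trans (ce t Kt); rewrite ler_wpM2l ?(ltW c0) //.
  by rewrite lerXn2r ?nnegrE ?ltW // (lt_trans x0).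
have zx : z - x = dl * x by rewrite /z mulrDl mul1r addrAC subrr add0r.
have : c * x ^+ mu0 * (dl * x) <= e t * (z - x).
  by rewrite zx ler_wpM2r // mulr_ge0 // ltW.
rewrite -E => h; have : c * dl * x ^+ mu0.+1 = c * x ^+ mu0 * (dl * x).
  by rewrite exprS; ring.
by move: h dx fzy fy; clear; lra.
Qed.

Lemma separated_count f (d : R) (n : nat) (Z : {fset R}) (y : R) : #|` Z| = n.+1 ->
  {in Z, forall z, z < y /\ f z + d <= f y} ->
  {in Z &, forall z w, z < w -> f z + d <= f w} ->
  exists2 z, z \in Z & f z + n.+1%:R * d <= f y.
Proof.
elim: n Z y => [|n IH] Z y cZ Zy ZZ.
  have [z zZ] : exists z, z \in Z by apply/fset0Pn; rewrite -cardfs_gt0 cZ.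
  by exists z => //; rewrite mul1r; have [] := Zy z zZ.
have [w wZ wmax] : exists2 w, w \in enum_fset Z & {in enum_fset Z, forall z, z <= w}.
  by apply: ex_max_seq; apply/eqP => Z0; move: cZ; rewrite Z0.
have subZ z : z \in (Z `\ w)%fset -> z \in Z by rewrite !inE => /andP[].
have zw z : z \in (Z `\ w)%fset -> z < w.
  by move=> zZ; rewrite lt_neqAle wmax ?subZ // andbT; move: zZ; rewrite !inE => /andP[].
have [|||z zZ zle] := IH (Z `\ w)%fset w.
- by move: cZ; rewrite (cardfsD1 w) wZ => -[].
- by move=> z zZ; split; [exact: zw|exact: ZZ (subZ _ zZ) wZ (zw _ zZ)].
- by move=> z v zZ vZ; apply: ZZ; exact: subZ.
exists z; first exact: subZ.
have [_ wy] := Zy w wZ; rewrite -[n.+2]addn1 natrD mulrDl mul1r.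
by move: zle wy; clear; lra.
Qed.

(** The [r] points below [y] make [f] climb by at least [r * d] before [y], while the bound on the
    derivative allows at most [c * y ^+ mu0.+1]. So only boundedly many points of a level set can
    violate the smallness of [d] required by [shift_close]. *)
Lemma separated_bound K f e (mu0 r : nat) (c d : R) (X : {fset R}) (y : R) :
  is_interval K -> positive_set K ->
  (forall x, K x -> is_derive x 1 f (e x)) -> 0 < c ->
  (forall x, K x -> e x <= c * x ^+ mu0) -> {in X, forall x, K x} ->
  {in X &, forall z w, z < w -> f z + d <= f w} -> 0 <= d ->
  y \in X -> (r <= #|` below X y|)%N -> r%:R * d <= c * y ^+ mu0.+1.
Proof.
move=> iK K0 df c0 ec XK Xsep d0 yX; have y0 := K0 y (XK y yX).
move=> rb; have bX z : z \in below X y -> z \in X /\ z < y by rewrite !inE => /andP[].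
case E : #|` below X y| => [|n].
  by move: rb; rewrite E leqn0 => /eqP->; rewrite mul0r mulr_ge0 ?exprn_ge0 ?ltW.
have [|z w|z zb zle] := separated_count E _ _ (f := f) (d := d) (y := y).
- by move=> z /bX[zX zy]; split => //; exact: Xsep.
- by move=> /bX[zX _] /bX[wX _]; exact: Xsep.
have [zX zy] := bX z zb; have [Kz Ky] := (XK z zX, XK y yX).
have [t /andP[zt ty] Et] := MVT_on iK df Kz Ky zy.
have Kt : K t by apply: (iK z y) => //; rewrite !ltW.
have t0 := K0 t Kt; have z0 := K0 z Kz.
have h1 : r%:R * d <= n.+1%:R * d by rewrite ler_wpM2r // ler_nat -E.
have h2 : e t * (y - z) <= c * y ^+ mu0 * y.
  apply: (@le_trans _ _ (c * y ^+ mu0 * (y - z))).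
    rewrite ler_wpM2r ?subr_ge0 ?(ltW zy) //; apply: le_trans (ec t Kt) _.
    by rewrite ler_wpM2l ?(ltW c0) // lerXn2r ?nnegrE ?ltW.
  rewrite ler_wpM2l ?mulr_ge0 ?exprn_ge0 ?(ltW c0) ?(ltW y0) //.
  by rewrite lerBlDr lerDl ltW.
rewrite exprSr mulrA; move: h1 h2 zle Et; clear; lra.
Qed.

Lemma ex_successor (A : {fset R}) : A != fset0 ->
  exists (A0 : {fset R}) (nxt : R -> R), successor_on A A0 nxt.
Proof.
move=> An0; pose A0 := [fset a in A | has (fun b => a < b) A]%fset.
have A0P a : a \in A0 -> a \in A /\ exists2 b, b \in A & a < b.
  by rewrite !inE => /andP[aA /hasP[b]]; split => //; exists b.
have /boolp.choice[nxt nP] : forall a : R, exists b, a \in A0 ->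
    [/\ b \in A, a < b & {in A, forall c, a < c -> b <= c}].
  move=> a; have [aA0|] := boolP (a \in A0); last by exists 0.
  have [aA [b bA ab]] := A0P a aA0.
  have [|v] := @ex_max_seq R [seq - c | c <- [seq c <- enum_fset A | a < c]].
    apply/eqP => E; have : - b \in [seq - c | c <- [seq c <- enum_fset A | a < c]].
      by apply: map_f; rewrite mem_filter ab.
    by rewrite E.
  move=> /mapP[x]; rewrite mem_filter => /andP[ax xA] -> xmax.
  exists x => _; split => // c cA ac; rewrite -lerN2; apply: xmax.
  by apply: map_f; rewrite mem_filter ac.
exists A0, nxt; split.
- by apply/fsubsetP => a /A0P[].
- have [w wA wmax] : exists2 w, w \in enum_fset A & {in enum_fset A, forall z, z <= w}.
    by apply: ex_max_seq; apply/eqP => A0'; move: An0; rewrite -cardfs_gt0 A0'.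
  rewrite -add1n -(cardfs1 w); apply: (@leq_trans #|` ([fset w] `|` A0)%fset|); last first.
    by rewrite cardfsU leq_subr.
  apply/fsubset_leq_card/fsubsetP => a aA; rewrite !inE aA /=.
  have [->|aw] := eqVneq a w; first by rewrite ?eqxx.
  by apply/orP; right; apply/hasP; exists w => //; rewrite lt_neqAle aw wmax.
- by move=> a /nP[].
- by move=> a b /nP[_ _ H] bA; exact: H.
Qed.

(** Indices are natural numbers rather than ordinals, so that deleting the first row and column of
    [L] is a mere shift of indices. *)
Definition triangular m (mu : nat -> nat) (c : nat -> R) (L : nat -> nat -> R) :=
  [/\ forall i j, (i < j)%N -> (j <= m)%N -> (mu i < mu j)%N,
      forall j, (j <= m)%N -> c j != 0,
      forall i j, (i < j)%N -> (j <= m)%N -> L i j = 0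
    & forall i, (i <= m)%N -> L i i != 0].

(** The first nonzero entry of row [i], in column [j0], dominates near 0: the later terms have
    larger exponents and gain a factor [x]. The sign is that of [s = L i j0 * c j0]. *)
Lemma dominant_sign m mu c L i : triangular m mu c L -> (i <= m)%N ->
  exists2 s : R, s != 0 & exists2 dl : R, 0 < dl &
  forall K (e : nat -> R -> R), positive_set K -> (forall x, K x -> x < dl) ->
    (forall j, (j <= m)%N -> power_like 0 K dl (c j) (mu j) (e j)) ->
    forall x, K x -> 0 < s * \sum_(j < m.+1) L i j * e j x.
Proof.
move=> [muP cP L0 LP] im.
have exj : exists j, L i j != 0 by exists i; exact: LP.
have [j0 Lj0 jmin] := ex_minnP exj.
have j0i : (j0 <= i)%N by apply: jmin; exact: LP.
have j0m : (j0 <= m)%N := leq_trans j0i im.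
pose s := L i j0 * c j0; have s0 : s != 0 by rewrite mulf_neq0 // cP.
have ns0 : 0 < `|s| by rewrite normr_gt0.
pose B := \sum_(j < m.+1) `|L i j| * (`|c j| + 1).
have B0 : 0 <= B by apply: sumr_ge0 => j _; rewrite mulr_ge0 // addr_ge0.
exists s => //; pose dl := Num.min 1 (`|s| / (B + 1)).
have B1 : 0 < B + 1 by rewrite ltr_wpDl.
have dl0 : 0 < dl by rewrite lt_min ltr01 divr_gt0.
exists dl => // K e K0 Kdl eP x Kx; have x0 := K0 x Kx.
have dl1 : dl <= 1 by rewrite ge_min lexx.
have dlB : B * dl < `|s|.
  apply: (@lt_le_trans _ _ ((B + 1) * dl)); first by rewrite ltr_pM2r // ltrDl.
  by rewrite mulrC -ler_pdivlMr // ge_min lexx orbT.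
pose X := x ^+ mu j0; have X0 : 0 < X by rewrite exprn_gt0.
have val j : (j <= m)%N -> `|e j x - c j * x ^+ mu j| <= dl * x ^+ mu j.
  by move=> jm; have := power_like_val (eP j jm) Kx.
have sE : s * X = \sum_(j < m.+1) (if (j : nat) == j0 then s * X else 0).
  by rewrite -big_mkcond /= (big_pred1 (Ordinal (j0m : (j0 < m.+1)%N))).
have err : `|\sum_(j < m.+1) L i j * e j x - s * X| <= B * (dl * X).
  rewrite sE -sumrB (le_trans (ler_norm_sum _ _ _)) // mulr_suml ler_sum // => j _.
  have jm : (j <= m)%N by rewrite -ltnS ltn_ord.
  have dX : 0 <= dl * X by rewrite mulr_ge0 ?ltW.
  have [jj0|jj0] := eqVneq (j : nat) j0.
    rewrite /s -jj0 -mulrA -mulrBr normrM -mulrA ler_wpM2l //.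
    apply: (@le_trans _ _ (1 * (dl * X))).
      by rewrite mul1r /X -jj0 val.
    by rewrite ler_wpM2r // lerDr.
  rewrite subr0 normrM -mulrA; have [jlt|jgt] := ltnP j j0.
    suff -> : L i j = 0 by rewrite normr0 !mul0r.
    by apply/eqP/negPn/negP => /jmin; rewrite leqNgt jlt.
  rewrite ler_wpM2l //.
  have mulj : (mu j0 < mu j)%N by apply: muP => //; rewrite ltn_neqAle eq_sym jj0.
  have xX : x ^+ mu j <= dl * X.
    have -> : x ^+ mu j = x ^+ (mu j - (mu j0).+1) * x * X.
      by rewrite /X -exprSr -exprD; congr (_ ^+ _); move: mulj; clear; lia.
    rewrite ler_wpM2r ?(ltW X0) //; apply: (@le_trans _ _ (1 * x)).
      rewrite ler_wpM2r ?(ltW x0) // exprn_ile1 ?(ltW x0) //.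
      by rewrite (le_trans _ dl1) // ltW // Kdl.
    by rewrite mul1r ltW // Kdl.
  apply: (@le_trans _ _ ((`|c j| + 1) * x ^+ mu j)); last first.
    by rewrite ler_wpM2l // addr_ge0.
  have xj0 : 0 <= x ^+ mu j by rewrite exprn_ge0 // ltW.
  rewrite -(subrK (c j * x ^+ mu j) (e j x)) (le_trans (ler_normD _ _)) //.
  rewrite normrM (ger0_norm xj0) addrC mulrDl lerD2l (le_trans (val j jm)) //.
  by rewrite ler_wpM2r.
set S := \sum_(j < m.+1) _ in err *.
have sD : `|s * (S - s * X)| < s * s * X.
  rewrite normrM; apply: (@lt_le_trans _ _ (`|s| * (`|s| * X))).
    by rewrite ltr_pM2l // (le_lt_trans err) // mulrA ltr_pM2r.
  by rewrite mulrA -normrM ger0_norm // -expr2 sqr_ge0.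
have -> : s * S = s * s * X + s * (S - s * X) by ring.
by move: sD; rewrite ltr_norml => /andP[]; clear; lra.
Qed.

End Shift.

(** * Induction on the number of functions, uniform over systems of a given shape *)

Section Uniform.
Set Implicit Arguments.
Unset Strict Implicit.
Context {R : realType}.
Implicit Types (K : set R) (k m : nat).

Lemma common_bound n (d : nat -> R) : (forall i, (i <= n)%N -> 0 < d i) ->
  exists2 dl, 0 < dl & forall i, (i <= n)%N -> dl <= d i.
Proof.
elim: n => [|n IH] d0.
  by exists (d 0%N) => [|i]; [exact: d0|rewrite leqn0 => /eqP->].
have [i /leqW /d0//|dl dl0 dlP] := IH; exists (Num.min dl (d n.+1)).
  by rewrite lt_min dl0 d0.
move=> i; rewrite leq_eqVlt => /predU1P[->|]; first by rewrite ge_min lexx orbT.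
by rewrite ltnS => /dlP; apply: le_trans; rewrite ge_min lexx.
Qed.

(** This is how an [e_j] of the system changes when each [f_i] is replaced by its difference along
    the shift. One derivative is lost, matching the loss of one function. *)
Lemma power_like_step m (c0 : R) (mu0 : int) (c : R) (mu : int) (eps : R) :
  c0 != 0 -> 0 < eps ->
  exists2 dl, 0 < dl & forall K K' f0 e0 s d e1,
    positive_set K -> is_interval K -> K' `<=` K ->
    (forall x, K x -> is_derive x 1 f0 (e0 x)) ->
    power_like m.+1 K dl c0 mu0 e0 ->
    (forall x, K' x -> [/\ K (s x), x < s x <= (1 + dl) * x, f0 (s x) = f0 x + d
                        & is_derive x 1 s (e0 x / e0 (s x))]) ->
    power_like m.+1 K dl c mu e1 ->
    power_like m K' eps (c0 * (c / c0 * (mu - mu0)%:~R / c0))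
      (mu0 + (mu - mu0 - 1 - mu0))
      (fun x => e0 x * ((e1 (s x) / e0 (s x) - e1 x / e0 x) / d)).
Proof.
move=> c00 eps0.
have [da da0 Pa] := @power_like_mul _ m c0 (c / c0 * (mu - mu0)%:~R / c0) mu0
  (mu - mu0 - 1 - mu0) _ eps0.
have [db db0 Pb] := @power_like_diff _ m c0 mu0 (c / c0) (mu - mu0) _ c00 da0.
have [dc dc0 Pc] := @power_like_mul _ m.+1 c c0^-1 mu (- mu0) _ db0.
have [dd dd0 Pd] := @power_like_inv _ m.+1 c0 mu0 _ c00 dc0.
pose dl := Num.min (Num.min da db) (Num.min dc dd).
have la : dl <= da by rewrite /dl !ge_min lexx.
have lb : dl <= db by rewrite /dl !ge_min lexx !orbT.
have lc : dl <= dc by rewrite /dl !ge_min lexx !orbT.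
have ld : dl <= dd by rewrite /dl !ge_min lexx !orbT.
exists dl => [|K K' f0 e0 s d e1 K0 iK KK' df0 ae0 sP ae1].
  by rewrite /dl !lt_min da0 db0 dc0.
have [|_ aie0] := Pd K e0 K0; first exact: power_like_weaken ae0.
have ah : power_like m.+1 K db (c / c0) (mu - mu0) (fun x => e1 x / e0 x).
  by apply: Pc => //; exact: power_like_weaken ae1.
apply: Pa; [by move=> x /KK' /K0|exact: power_like_weaken ae0|].
apply: (Pb K K' f0 e0 s d (fun x => e1 x / e0 x)) => //.
  exact: power_like_weaken ae0.
move=> x K'x; have [Ks /andP[xs sx] fs ds] := sP x K'x; split => //.
by rewrite xs (le_trans sx) // ler_wpM2r ?lerD2l // ltW // K0 //; exact: KK'.
Qed.

Definition admissible m K (dl : R) (mu : nat -> nat) (c : nat -> R)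
    (L : nat -> nat -> R) (f e : nat -> R -> R) :=
  [/\ open K, is_interval K, positive_set K, (forall x, K x -> x < dl) &
      (forall j, (j <= m)%N -> power_like m K dl (c j) (mu j) (e j)) /\
      (forall i x, (i <= m)%N -> K x ->
         is_derive x 1 (f i) (\sum_(j < m.+1) L i j * e j x))].

Definition grows m (C : R) (f : nat -> R -> R) (A : {fset R}) :=
  exists2 i, (i <= m)%N & C * #|` A|%:R `^ phi R m.+1 <=
                       #|` sumdiff_between m (f i @` A)%fset|%:R.

Lemma grows_scale m C f (s : nat -> R) A : (forall i, (i <= m)%N -> s i != 0) ->
  grows m C (fun i x => s i * f i x) A -> grows m C f A.
Proof.
move=> s0 [i im iC]; exists i => //; apply: le_trans iC _; rewrite ler_nat.
have si : (s i)^-1 != 0 by rewrite invr_eq0 s0.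
apply: leq_trans (card_sumdiff_betweenZ m (fun x => s i * f i x) A si) _.
suff -> : (fun x => (s i)^-1 * (s i * f i x)) = f i by [].
by apply/funext => x; rewrite mulKf // s0.
Qed.

(** [dl] and [C] depend only on the shape [mu], [c], [L], so one pair serves the derived systems for
    all gaps [d]. The predicate [P] lets a sign condition on the derivatives be imposed
    temporarily. *)
Definition growth_at m mu c L (P : (nat -> R -> R) -> set R -> Prop) :=
  exists2 dl : R, 0 < dl & exists2 C : R, 0 < C &
  forall K f e, admissible m K dl mu c L f e ->
    P (fun i x => \sum_(j < m.+1) L i j * e j x) K ->
    forall A : {fset R}, A != fset0 -> {in A, forall x, K x} -> grows m C f A.

Lemma growth_base mu c L : triangular 0 mu c L ->
  growth_at 0 mu c L (fun _ _ => True).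
Proof.
move=> tr; have [s s0 [dl dl0 H]] := dominant_sign tr (leqnn 0).
exists dl => //; exists 1 => // K f e [oK iK K0 Kdl [ae df]] _ A An0 AK.
have inc := @derive_pos_increasing _ K (fun x => s * f 0%N x) _ iK _ (H K e K0 Kdl ae).
have {}inc x y : K x -> K y -> x < y -> s * f 0%N x < s * f 0%N y.
  by apply: inc => z Kz; exact: (@is_deriveZ _ _ _ (f 0%N) s z 1 _ (df _ z (leqnn 0) Kz)).
exists 0%N => //; rewrite mul1r powRr1 // ler_nat.
apply: leq_trans (fsubset_leq_card (sub_sumdiff_between 0 _)).
rewrite card_in_imfset // => x y xA yA fxy; have [xy|yx|//] := ltgtP x y.
  by have := inc x y (AK x xA) (AK y yA) xy; rewrite fxy ltxx.
by have := inc y x (AK y yA) (AK x xA) yx; rewrite fxy ltxx.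
Qed.

(** Positive derivatives make every [f i] increasing, as [growth_step] demands. The analysis
    verifies its hypothesis on level sets by exhibiting the differences there as an admissible
    system with one function fewer. *)
Lemma growth_induct m mu c L : triangular m.+1 mu c L ->
  (forall mu' c' L', triangular m mu' c' L' -> growth_at m mu' c' L' (fun _ _ => True)) ->
  growth_at m.+1 mu c L
    (fun phi K => forall i x, (i <= m.+1)%N -> K x -> 0 < phi i x).
Proof.
move=> [muP cP L0 LP] IH.
pose c0 := L 0%N 0%N * c 0%N.
have c00 : c0 != 0 by rewrite mulf_neq0 ?LP ?cP.
have nc0 : 0 < `|c0| by rewrite normr_gt0.
(* The truncated subtraction is exact because the exponents increase strictly, and the new exponents
   are again natural numbers. *)
pose mu' j := (mu j.+1 - mu 0%N - 1)%N.
pose c' j := c0 * (c j.+1 / c0 * ((mu j.+1)%:Z - (mu 0%N)%:Z)%:~R / c0).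
pose L' i j := L i.+1 j.+1.
have mu0P j : (j <= m)%N -> (mu 0%N < mu j.+1)%N by move=> jm; exact: muP.
have mu'E j : (j <= m)%N -> ((mu 0%N)%:Z + ((mu j.+1)%:Z - (mu 0%N)%:Z - 1 - (mu 0%N)%:Z)
    = (mu' j)%:Z)%R by move=> /mu0P; rewrite /mu'; lia.
have tr' : triangular m mu' c' L'.
  split=> [i j ij jm|j jm|i j ij jm|i im].
  - have := muP i.+1 j.+1 ij jm; have := mu0P i (leq_trans (ltnW ij) jm).
    by rewrite /mu'; lia.
  - have z0 : ((mu j.+1)%:Z - (mu 0%N)%:Z)%:~R != 0 :> R.
      by rewrite intr_eq0 subr_eq0 eqz_nat gtn_eqF // mu0P.
    have ci : c0^-1 != 0 by rewrite invr_eq0.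
    exact: mulf_neq0 c00 (mulf_neq0 (mulf_neq0 (mulf_neq0 (cP j.+1 jm) ci) z0) ci).
  - exact: L0.
  - exact: LP.
have [dl1 dl10 [C1 C10 P1]] := IH mu' c' L' tr'.
have /boolp.choice[s' s'P] : forall i, exists w : R * R, (i <= m)%N ->
    [/\ w.1 != 0, 0 < w.2 & forall K (e : nat -> R -> R), positive_set K ->
      (forall x, K x -> x < w.2) ->
      (forall j, (j <= m)%N -> power_like 0 K w.2 (c' j) (mu' j) (e j)) ->
      forall x, K x -> 0 < w.1 * \sum_(j < m.+1) L' i j * e j x].
  move=> i; have [im|] := boolP (i <= m)%N; last by exists (0, 0).
  by have [s s0 [dl dl0 H]] := dominant_sign tr' im; exists (s, dl).
have [dl2 dl20 P2] := @common_bound m (fun i => (s' i).2) (fun i im => 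
  let: And3 _ h _ := s'P i im in h).
have [eps eps0 [eps1 eps2]] : exists2 eps, 0 < eps & eps <= dl1 /\ eps <= dl2.
  by exists (Num.min dl1 dl2); rewrite ?lt_min ?dl10 // !ge_min !lexx orbT.
have /boolp.choice[dj djP] : forall j, exists dl : R, 0 < dl /\ forall K K' f0 e0 s d e1,
    positive_set K -> is_interval K -> K' `<=` K ->
    (forall x, K x -> is_derive x 1 f0 (e0 x)) ->
    power_like m.+1 K dl c0 (mu 0%N) e0 ->
    (forall x, K' x -> [/\ K (s x), x < s x <= (1 + dl) * x, f0 (s x) = f0 x + d
                        & is_derive x 1 s (e0 x / e0 (s x))]) ->
    power_like m.+1 K dl (c j.+1) (mu j.+1) e1 ->
    power_like m K' eps (c' j) ((mu 0%N)%:Z + ((mu j.+1)%:Z - (mu 0%N)%:Z - 1 - (mu 0%N)%:Z))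
      (fun x => e0 x * ((e1 (s x) / e0 (s x) - e1 x / e0 x) / d)).
  move=> j; have [dl dl0 H] := @power_like_step m c0 (mu 0%N) (c j.+1) (mu j.+1) _ c00 eps0.
  by exists dl.
have [dl3 dl30 dl3P] := @common_bound m dj (fun i _ => (djP i).1).
(* [d < kappa * x ^+ (mu 0).+1] is the condition of [shift_close] for the lower bound [|c0| / 2] on
   the coefficient of [e0]; [R0] is large enough for [separated_bound] to yield it. *)
pose kappa := `|c0| / 2 * dl3; have kappa0 : 0 < kappa by rewrite mulr_gt0 // divr_gt0.
pose R0 := Num.bound (2 * `|c0| / kappa).
have R0P : 2 * `|c0| < R0%:R * kappa.
  by rewrite -ltr_pdivrMr // archi_boundP // divr_ge0 ?mulr_ge0 ?ltW.
have [C C_gt0 CP] := @growth_step R m R0 C1 C10.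
(* The third bound keeps the error of [e0], which is scaled by [L 0 0], below [dl3]; the fourth
   keeps [e0] between half and twice its leading term in absolute value. *)
pose dl := Num.min (Num.min eps dl3) (Num.min (dl3 / (`|L 0%N 0%N| + 1)) (`|c 0%N| / 2)).
have L1 : 0 < `|L 0%N 0%N| + 1 by rewrite ltr_wpDl.
have lb1 : dl <= eps by rewrite /dl !ge_min lexx.
have lb2 : dl <= dl3 by rewrite /dl !ge_min lexx !orbT.
have lb3 : `|L 0%N 0%N| * dl <= dl3.
  apply: (@le_trans _ _ ((`|L 0%N 0%N| + 1) * (dl3 / (`|L 0%N 0%N| + 1)))); last first.
    by rewrite mulrC divfK // gt_eqF.
  have dl0' : 0 < dl3 / (`|L 0%N 0%N| + 1) by rewrite divr_gt0.
  apply: (@le_trans _ _ (`|L 0%N 0%N| * (dl3 / (`|L 0%N 0%N| + 1)))).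
    by rewrite ler_wpM2l // /dl !ge_min lexx !orbT.
  by rewrite ler_wpM2r ?(ltW dl0') // lerDl.
have lb4 : dl <= `|c 0%N| / 2 by rewrite /dl !ge_min lexx !orbT.
exists dl; first by rewrite /dl !lt_min eps0 dl30 !divr_gt0 // normr_gt0 cP.
exists C => // K f e [oK iK K0 Kdl [ae df]] phi0 A An0 AK.
pose e0 x := L 0%N 0%N * e 0%N x.
have e0E x : \sum_(j < m.+2) L 0%N j * e j x = e0 x.
  rewrite big_ord_recl /= big1 ?addr0 // => j _.
  by rewrite L0 ?mul0r // lift0 ltn_ord.
have e0pos x : K x -> 0 < e0 x by move=> Kx; rewrite -e0E; exact: phi0.
have df0 x : K x -> is_derive x 1 (f 0%N) (e0 x) by move=> Kx; rewrite -e0E; exact: df.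
have ae0 : power_like m.+1 K dl3 c0 (mu 0%N) e0.
  apply: power_like_weaken (power_likeZ (L 0%N 0%N) (ae 0%N isT)) => //.
have e0b x : K x -> `|c0| / 2 * x ^+ mu 0%N <= e0 x <= 2 * `|c0| * x ^+ mu 0%N.
  move=> Kx; have X0 : 0 < x ^+ mu 0%N by rewrite exprn_gt0 // K0.
  have : `|e0 x - c0 * x ^+ mu 0%N| <= `|c0| / 2 * x ^+ mu 0%N.
    have := power_like_val (ae 0%N isT) Kx => H.
    rewrite /e0 /c0 -mulrA -mulrBr !normrM -!mulrA ler_wpM2l //.
    by apply: le_trans H _; rewrite mulrA ler_wpM2r ?(ltW X0).
  have cX : `|c0 * x ^+ mu 0%N| = `|c0| * x ^+ mu 0%N by rewrite normrM (gtr0_norm X0).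
  have h1 : `|c0 * x ^+ mu 0%N| <= `|e0 x - c0 * x ^+ mu 0%N| + `|e0 x|.
    by rewrite distrC -{1}(subrK (e0 x) (c0 * x ^+ mu 0%N)) ler_normD.
  have h2 : `|e0 x| <= `|e0 x - c0 * x ^+ mu 0%N| + `|c0 * x ^+ mu 0%N|.
    by rewrite -{1}(subrK (c0 * x ^+ mu 0%N) (e0 x)) ler_normD.
  have cX0 : 0 < `|c0| * x ^+ mu 0%N by rewrite mulr_gt0.
  move: h1 h2; rewrite cX (gtr0_norm (e0pos x Kx)).
  by move: (`|e0 x - _|) cX0 => E; clear; lra.
have inc i x y : (i <= m.+1)%N -> K x -> K y -> x < y -> f i x < f i y.
  by move=> im; apply: (derive_pos_increasing iK (fun z => df i z im)) => z; exact: phi0.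
have [A0 [nxt sA]] := ex_successor An0; have [/fsubsetP A0A _ nxtP nxt_le] := sA.
apply: (CP A A0 nxt f) => //.
  by move=> i im x y xA yA; apply: inc => //; exact: AK.
move=> d X Y d0 /fsubsetP XA0 Xd /fsubsetP YX Ybelow G.
have [oS iS [s sP]] := shift_exists oK iK d0 df0 e0pos.
(* On [K'] the shift moves [x] by a factor at most [1 + dl3], so the estimates hold uniformly in
   [d]. *)
pose K' := shift_dom K (f 0%N) d `&` [set x | d < kappa * x ^+ (mu 0%N).+1].
have K'K : K' `<=` K by move=> x [[]].
have fle x y : K x -> K y -> x <= y -> f 0%N x <= f 0%N y.
  by move=> Kx Ky; rewrite le_eqVlt => /predU1P[->//|/(inc 0%N x y isT Kx Ky)/ltW].
have oK' : open K'.
  apply: openI => //.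
  pose g (x : R) : R := kappa * x ^+ (mu 0%N).+1.
  rewrite (_ : [set x | _] = g @^-1` [set y | d < y]) //.
  apply: open_comp; last exact: open_gt.
  move=> x _; apply: cvgM; first exact: cvg_cst.
  exact: exprn_continuous.
have iK' : is_interval K'.
  move=> x y [Sx kx] [Sy ky] z xzy; split; first exact: (iS x y).
  apply: lt_le_trans kx _; rewrite ler_wpM2l ?(ltW kappa0) //.
  have x0 : 0 < x by apply: K0; case: Sx.
  case/andP: xzy => xz _; have z0 := lt_le_trans x0 xz.
  by rewrite lerXn2r ?nnegrE ?(ltW x0) ?(ltW z0).
have sP' x : K' x -> [/\ K (s x), x < s x <= (1 + dl3) * x, f 0%N (s x) = f 0%N x + d
                        & is_derive x 1 s (e0 x / e0 (s x))].
  move=> [Sx kx]; have [Ks xs fs ds] := sP x Sx; split => //; rewrite xs /=.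
  have Kx : K x by case: Sx.
  apply: (shift_close iK K0 df0 (_ : 0 < `|c0| / 2) _ dl30 Kx Ks fs kx).
    by rewrite divr_gt0.
  by move=> z /e0b/andP[].
pose e' j x := e0 x * ((e j.+1 (s x) / e0 (s x) - e j.+1 x / e0 x) / d).
pose f' i x := (f i.+1 (s x) - f i.+1 x) / d.
have ae' j : (j <= m)%N -> power_like m K' eps (c' j) (mu' j) (e' j).
  move=> jm; rewrite -mu'E //; have [_ H] := djP j.
  have ldj := dl3P j jm.
  apply: (H K K' (f 0%N) e0 s d (e j.+1)) => //.
  - exact: power_like_weaken ae0.
  - move=> x K'x; have [Ks /andP[xs sx] fs ds] := sP' x K'x; split => //.
    by rewrite xs (le_trans sx) // ler_wpM2r ?lerD2l // ltW // K0 //; exact: K'K.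
  - by apply: power_like_weaken (ae j.+1 jm) => //; exact: le_trans lb2 ldj.
have df' i x : (i <= m)%N -> K' x ->
    is_derive x 1 (f' i) (\sum_(j < m.+1) L' i j * e' j x).
  move=> im K'x; have Kx := K'K x K'x; have [Ks _ _ ds] := sP' x K'x.
  have D1 := is_derive1_comp (df i.+1 (s x) im Ks) ds.
  have := is_deriveZ d^-1 (is_deriveB D1 (df i.+1 x im Kx)).
  rewrite (_ : _ \*: _ = f' i); last first.
    by apply/funext => y; rewrite /f' /= /GRing.scale /= mulrC.
  move=> D; apply: is_derive_eq D _; rewrite /GRing.scale /=.
  have dn : d != 0 by rewrite gt_eqF.
  have n0 : e0 x != 0 by rewrite gt_eqF // e0pos.
  have ns0 : e0 (s x) != 0 by rewrite gt_eqF // e0pos.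
  rewrite mulr_suml -sumrB mulr_sumr big_ord_recl /=.
  (* The column [j = 0] disappears because [e 0 / e0] is constant: this is where one function is
     eliminated. *)
  rewrite (_ : d^-1 * _ = 0) ?add0r; last first.
    have l0 : L 0%N 0%N != 0 by exact: LP.
    have [m0 ms0] : e 0%N x != 0 /\ e 0%N (s x) != 0.
      by move: n0 ns0; rewrite /e0 !mulf_eq0 !negb_or => /andP[_ ->] /andP[_ ->].
    by rewrite /e0; field; rewrite ?dn ?l0 ?ms0.
  apply: eq_bigr => j _; rewrite /L' /e' /bump /= add1n.
  by field; rewrite ?dn ?n0 ?ns0.
have adm : admissible m K' dl1 mu' c' L' f' e'.
  split=> //; [by move=> x /K'K /K0| |split=> // j jm].
    by move=> x /K'K /Kdl xdl; apply: lt_le_trans xdl (le_trans lb1 eps1).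
  by apply: power_like_weaken (ae' j jm) => // x /K'K /K0.
have XK x : x \in X -> K x by move=> /XA0 /A0A /AK.
have nK x : x \in X -> K (nxt x) by move=> /XA0 /nxtP[/AK].
have XS x : x \in X -> shift_dom K (f 0%N) d x.
  move=> xX; split; first exact: XK.
  by exists (nxt x); [exact: nK|rewrite -(Xd x xX) addrC subrK].
have snxt x : x \in X -> s x = nxt x.
  move=> xX; have [Ks _ fs _] := sP x (XS x xX).
  have fn : f 0%N (nxt x) = f 0%N x + d by rewrite -(Xd x xX) addrC subrK.
  have [lt|gt|//] := ltgtP (s x) (nxt x).
    by have := inc 0%N _ _ isT Ks (nK x xX) lt; rewrite fs fn ltxx.
  by have := inc 0%N _ _ isT (nK x xX) Ks gt; rewrite fs fn ltxx.
(* With [R0] points of [X] below it, [x] satisfies [R0 * d <= 2 * |c0| * x ^+ (mu 0).+1], which is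
   less than [R0 * kappa * x ^+ (mu 0).+1]. *)
have YK' x : x \in Y -> K' x.
  move=> xY; have xX := YX x xY; split; first exact: XS.
  have Xsep : {in X &, forall z w, z < w -> f 0%N z + d <= f 0%N w}.
    move=> z w zX wX zw; rewrite -(Xd z zX) addrC subrK; apply: (fle _ _ (nK z zX) (XK w wX)).
    exact: nxt_le (XA0 z zX) (A0A w (XA0 w wX)) zw.
  have c20 : 0 < 2 * `|c0| by rewrite mulr_gt0.
  have e0le z : K z -> e0 z <= 2 * `|c0| * z ^+ mu 0%N by move=> /e0b/andP[].
  have := separated_bound iK K0 df0 c20 e0le XK Xsep (ltW d0) xX (Ybelow x xY).
  have x0 : 0 < x ^+ (mu 0%N).+1 by rewrite exprn_gt0 // K0 //; exact: XK.
  have R00 : 0 < R0%:R :> R.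
    by rewrite -(pmulr_lgt0 _ kappa0) (lt_trans c20).
  move=> h; have : R0%:R * d < R0%:R * kappa * x ^+ (mu 0%N).+1.
    by apply: le_lt_trans h _; rewrite ltr_pM2r.
  by rewrite -mulrA ltr_pM2l.
have Gf' i x : x \in X -> f i.+1 (nxt x) - f i.+1 x = d * f' i x.
  by move=> xX; rewrite /f' (snxt x xX) mulrC divfK // gt_eqF.
split.
  move=> i im; have [t0 _ H] := s'P i im.
  have pos := H K' e' (fun x K'x => K0 x (K'K x K'x)) _ _.
  have {}pos x : K' x -> 0 < (s' i).1 * \sum_(j < m.+1) L' i j * e' j x.
    apply: pos => [y /K'K /Kdl ydl|j jm].
      exact: lt_le_trans ydl (le_trans lb1 (le_trans eps2 (P2 i im))).
    apply: power_like_weaken (ae' j jm) => //; first by move=> y /K'K /K0.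
    exact: le_trans eps2 (P2 i im).
  have mono x y : K' x -> K' y -> x < y -> (s' i).1 * f' i x < (s' i).1 * f' i y.
    suff D z : K' z -> is_derive z 1 (fun x => (s' i).1 * f' i x)
        ((s' i).1 * \sum_(j < m.+1) L' i j * e' j z).
      exact: (derive_pos_increasing iK' D pos).
    move=> K'z; exact: (@is_deriveZ _ _ _ (f' i) (s' i).1 z 1 _ (df' i z im K'z)).
  have [tpos|tneg|teq] := ltgtP 0 (s' i).1; last by move: t0; rewrite -teq eqxx.
    left=> x y xY yY; rewrite le_eqVlt => /predU1P[->//|xy].
    rewrite /G !Gf' ?YX // ler_pM2l // -(ler_pM2l tpos) ltW //.
    exact: mono (YK' x xY) (YK' y yY) xy.
  right=> x y xY yY; rewrite le_eqVlt => /predU1P[->//|xy].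
  rewrite /G !Gf' ?YX // ler_pM2l // -(ler_nM2l tneg) ltW //.
  exact: mono (YK' _ _) (YK' _ _) xy.
move=> Yn0.
have [i im iC] := P1 K' f' e' adm I Y Yn0 YK'; exists i => //.
apply: le_trans iC _; rewrite ler_nat.
have dn0 : d != 0 by rewrite gt_eqF.
apply: leq_trans (card_sumdiff_betweenZ m (f' i) Y dn0) _.
suff -> : ((fun x => (d * f' i x)%R) @` Y)%fset = (G i @` Y)%fset by [].
by apply: eq_in_imfset => // x xY; rewrite /G Gf' // YX.
Qed.

(** Multiplying row [i] of [L] by the factor from [dominant_sign] makes all derivatives positive;
    [grows_scale] undoes the scaling. *)
Lemma uniform_growth m mu c L : triangular m mu c L ->
  growth_at m mu c L (fun _ _ => True).
Proof.
elim: m mu c L => [|m IH] mu c L tr; first exact: growth_base.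
have /boolp.choice[w wP] : forall i, exists w : R * R, (i <= m.+1)%N ->
    [/\ w.1 != 0, 0 < w.2 & forall K (e : nat -> R -> R), positive_set K ->
      (forall x, K x -> x < w.2) ->
      (forall j, (j <= m.+1)%N -> power_like 0 K w.2 (c j) (mu j) (e j)) ->
      forall x, K x -> 0 < w.1 * \sum_(j < m.+2) L i j * e j x].
  move=> i; have [im|] := boolP (i <= m.+1)%N; last by exists (0, 0).
  by have [s s0 [dl dl0 H]] := dominant_sign tr im; exists (s, dl).
have w2 i : (i <= m.+1)%N -> 0 < (w i).2 by move=> /wP[].
have [d1 d10 d1P] := common_bound w2.
pose L' i j := (w i).1 * L i j.
have tr' : triangular m.+1 mu c L'.
  case: tr => muP cP L0 LP; split => // [i j ij jm|i im]; first by rewrite /L' L0 ?mulr0.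
  by rewrite mulf_neq0 ?LP //; case: (wP i im).
have [d2 d20 [C C0 H]] := growth_induct tr' IH.
exists (Num.min d1 d2); first by rewrite lt_min d10.
exists C => // K f e [oK iK K0 Kd [ae df]] _ A An0 AK.
have ld1 : Num.min d1 d2 <= d1 by rewrite ge_min lexx.
have ld2 : Num.min d1 d2 <= d2 by rewrite ge_min lexx orbT.
apply: (@grows_scale _ _ _ (fun i => (w i).1)); first by move=> i /wP[].
apply: (H K _ e) => //.
  split => //; first by move=> x /Kd /lt_le_trans; apply.
  split=> [j jm|i x im Kx]; first exact: power_like_weaken (ae j jm).
  have := @is_deriveZ _ _ _ (f i) (w i).1 x 1 _ (df i x im Kx).
  move=> D; apply: is_derive_eq D _; rewrite /GRing.scale /= mulr_sumr.
  by apply: eq_bigr => j _; rewrite mulrA.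
move=> i x im Kx; have [_ _ P] := wP i im.
have := P K e K0 _ _ x Kx; rewrite mulr_sumr.
rewrite (eq_bigr (fun j : 'I_m.+2 => L' i j * e j x)); last by move=> j _; rewrite mulrA.
apply=> [y /Kd /lt_le_trans|j jm]; first by apply; exact: le_trans ld1 (d1P i im).
apply: power_like_weaken (ae j jm) => //; exact: le_trans ld1 (d1P i im).
Qed.

End Uniform.

(** * Power series: differentiation and behaviour at the centre *)

Section PowerSeries.
Set Implicit Arguments.
Unset Strict Implicit.
Context {R : realType}.
Implicit Types (b u v : nat -> R) (r : R) (phi : R -> R).

Lemma mul_geometric_le (q : R) i : 0 <= q -> q <= 1 ->
  i.+1%:R * q ^+ i * (1 - q) <= 1 - q ^+ i.+1.
Proof.
move=> q0 q1; elim: i => [|i IH]; first by rewrite expr0 expr1 !mul1r.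
have Q0 : 0 <= q ^+ i.+1 by rewrite exprn_ge0.
have Q1 : q ^+ i.+1 <= 1 by rewrite exprn_ile1.
have E : i.+2%:R * q ^+ i.+1 * (1 - q) = q * (i.+1%:R * q ^+ i * (1 - q))
    + q ^+ i.+1 * (1 - q).
  by rewrite -[i.+2]addn1 natrD [q ^+ i.+1]exprS; ring.
rewrite E; apply: le_trans (lerD (ler_wpM2l q0 IH) (lexx _)) _.
rewrite [q ^+ i.+2]exprS; move: (q ^+ i.+1) Q0 Q1 => Q Q0 Q1.
by have := mulr_ge0 (_ : 0 <= 1 - q) (_ : 0 <= 1 - Q); nra.
Qed.

Lemma is_cvg_pseries_diffs b (x z : R) : cvgn (pseries b x) -> `|z| < `|x| ->
  cvgn (pseries (pseries_diffs b) z).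
Proof.
move=> Cx zx; have [K [Kreal Kf]] := cvg_series_bounded Cx.
have x0 : 0 < `|x| := le_lt_trans (normr_ge0 z) zx.
pose M : R := `|K + 1|; pose q : R := `|z| / `|x|.
have q0 : 0 <= q by rewrite divr_ge0.
have q1 : q < 1 by rewrite ltr_pdivrMr // mul1r.
(* Writing [q ^+ n] as [p ^+ n * p ^+ n], one factor absorbs [n.+1] by [mul_geometric_le] and the
   other leaves a convergent geometric series. *)
pose p := Num.sqrt q; have p0 : 0 <= p := sqrtr_ge0 _.
have p1 : p < 1 by rewrite -sqrtr1 ltr_sqrt.
have pq : p * p = q by rewrite -expr2 sqr_sqrtr.
have p10 : 0 < 1 - p by rewrite subr_gt0.
apply: normed_cvg; apply: (@series_le_cvg _ _ (geometric (M / `|x| / (1 - p)) p)) => //=.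
- by move=> n; apply: geometric_ge0 p0; rewrite divr_ge0 ?(ltW p10) // divr_ge0 // normr_ge0.
- move=> n; rewrite /pseries_diffs normrM normrM normrX ger0_norm //.
  have bn : `|b n.+1| * `|x| ^+ n.+1 <= M.
    rewrite -normrX -normrM; apply: (Kf (`|K + 1|)) => //.
    by rewrite (lt_le_trans _ (ler_norm _)) // ltrDl.
  have -> : n.+1%:R * `|b n.+1| * `|z| ^+ n =
      (`|b n.+1| * `|x| ^+ n.+1) / `|x| * ((n.+1%:R * p ^+ n) * p ^+ n).
    have pn : p ^+ n * p ^+ n = `|z| ^+ n / `|x| ^+ n by rewrite -exprMn pq expr_div_n.
    rewrite -(mulrA n.+1%:R (p ^+ n)) pn exprS.
    have xn : `|x| ^+ n != 0 by rewrite expf_neq0 // gt_eqF.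
    by field; rewrite xn gt_eqF.
  have h : n.+1%:R * p ^+ n <= (1 - p)^-1.
    rewrite -[leRHS]mul1r ler_pdivlMr //.
    apply: le_trans (mul_geometric_le n p0 (ltW p1)) _.
    by rewrite gerBl exprn_ge0.
  rewrite -[leRHS]mulrA; apply: ler_pM; rewrite ?mulr_ge0 ?exprn_ge0 ?invr_ge0 //.
    by rewrite ler_wpM2r // invr_ge0.
  by rewrite ler_wpM2r ?exprn_ge0.
- by apply: is_cvg_geometric_series; rewrite ger0_norm.
Qed.

Definition has_pseries b r phi := forall t : R, `|t| < r -> pseries b t @ \oo --> phi t.

Lemma has_pseries_unique b r phi psi : has_pseries b r phi -> has_pseries b r psi ->
  forall t : R, `|t| < r -> phi t = psi t.
Proof. by move=> H H' t tr; apply: cvg_unique (H t tr) (H' t tr). Qed.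

Lemma has_pseries_at0 b r phi : 0 < r -> has_pseries b r phi -> phi 0 = b 0%N.
Proof.
move=> r0 /(_ 0); rewrite normr0 => /(_ r0) H; apply: cvg_unique H _ => //.
apply: cvg_near_cst; exists 1%N => // -[//|n] _.
rewrite /pseries /series /= big_nat_recl // expr0 mulr1.
by rewrite big1 ?addr0 // => i _; rewrite expr0n /= mulr0.
Qed.

Lemma has_pseries_lin (a : R) u v r phi psi : has_pseries u r phi -> has_pseries v r psi ->
  has_pseries (fun k => u k + a * v k) r (fun t => phi t + a * psi t).
Proof.
move=> H H' t tr.
have -> : pseries (fun k => u k + a * v k) t = pseries u t \+ (cst a \* pseries v t).
  apply/funext => n; rewrite /pseries /series /= mulr_sumr -big_split /=.
  by apply: eq_bigr => i _; rewrite mulrDl mulrA.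
by apply: cvgD; [exact: H|apply: cvgM; [exact: cvg_cst|exact: H']].
Qed.

Lemma has_pseriesN b r phi : has_pseries b r phi ->
  has_pseries (fun k => (-1) ^+ k * b k) r (fun t => phi (- t)).
Proof.
move=> H t tr.
have -> : pseries (fun k => (-1) ^+ k * b k) t = pseries b (- t).
  apply/funext => n; rewrite /pseries /series /=; apply: eq_bigr => i _.
  by rewrite -[- t]mulN1r exprMn; ring.
by apply: H; rewrite normrN.
Qed.

Lemma has_pseries_derive b r phi : has_pseries b r phi ->
  exists2 phi', has_pseries (pseries_diffs b) r phi' &
    forall t : R, `|t| < r -> is_derive t 1 phi (phi' t).
Proof.
move=> H; have cvgb (w : R) : `|w| < r -> cvgn (pseries b w).
  by move=> wr; apply/cvg_ex; exists (phi w); exact: H.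
have mid (w : R) : `|w| < r -> exists2 y : R, `|w| < `|y| & `|y| < r.
  move=> wr; have w0 := normr_ge0 w.
  have y0 : 0 <= (`|w| + r) / 2 by move: w0 wr; clear; lra.
  by exists ((`|w| + r) / 2); rewrite (ger0_norm y0); move: wr; clear; lra.
have cvgd (w : R) : `|w| < r -> cvgn (pseries (pseries_diffs b) w).
  by move=> /mid[y wy /cvgb yr]; exact: is_cvg_pseries_diffs yr wy.
have cvgdd (w : R) : `|w| < r -> cvgn (pseries (pseries_diffs (pseries_diffs b)) w).
  by move=> /mid[y wy /cvgd yr]; exact: is_cvg_pseries_diffs yr wy.
exists (fun t => limn (pseries (pseries_diffs b) t)) => t tr; first exact: cvgd.
have [y ty yr] := mid t tr.
apply: (@near_eq_is_derive _ _ _ (fun t => limn (pseries b t))); last first.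
  exact: pseries_snd_diffs (cvgb y yr) (cvgd y yr) (cvgdd y yr) ty.
near=> w; apply: cvg_lim => //; apply: H.
suff : ball t (r - `|t|) w.
  rewrite /ball /= => tw; rewrite -(subKr t w) (le_lt_trans (ler_normB _ _)) //.
  by move: tw; lra.
by near: w; apply: nbhsx_ballx; rewrite subr_gt0.
Unshelve. all: by end_near.
Qed.

Lemma has_pseries_cont0 b r phi : 0 < r -> has_pseries b r phi -> forall dl : R, 0 < dl ->
  exists2 eps : R, 0 < eps & forall t : R, `|t| < eps -> `|phi t - b 0%N| <= dl.
Proof.
move=> r0 H dl dl0; have [phi' _ dphi] := has_pseries_derive H.
have /is_derive_continuous : is_derive (0 : R) 1 phi (phi' 0) by apply: dphi; rewrite normr0.
move=> /cvgrPdist_le /(_ dl dl0); rewrite -nbhs_nearE => /nbhs_ballP[eps /= eps0 He].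
exists eps => // t te; rewrite -(has_pseries_at0 r0 H) distrC; apply: He.
by rewrite /ball /= sub0r normrN.
Qed.

(* Integrating the estimate for the derivative raises the order by one. *)
Lemma has_pseries_leading m b r phi : 0 < r -> has_pseries b r phi ->
  (forall k, (k < m)%N -> b k = 0) -> forall dl : R, 0 < dl ->
  exists2 eps : R, 0 < eps &
    forall t : R, 0 < t < eps -> `|phi t - b m * t ^+ m| <= dl * t ^+ m.
Proof.
elim: m b phi => [|m IH] b phi r0 H b0 dl dl0.
  have [eps eps0 He] := has_pseries_cont0 r0 H dl0; exists eps => // t /andP[t0 te].
  by rewrite expr0 !mulr1 He // gtr0_norm.
have [phi' H' dphi] := has_pseries_derive H.
have [k km|eps1 eps10 He] := IH _ _ r0 H' _ _ dl0.
  by rewrite /pseries_diffs b0 ?mulr0.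
exists (Num.min eps1 r); first by rewrite lt_min eps10.
move=> t; rewrite lt_min => /and3P[t0 te tr].
pose g (s : R) := phi s - b m.+1 * s ^+ m.+1.
pose g' (s : R) := phi' s - pseries_diffs b m * s ^+ m.
have dg (s : R) : `|s| < r -> is_derive s 1 g (g' s).
  move=> sr; have dX := is_deriveX m.+1 (@is_derive_id _ _ s (1 : R)).
  have := is_deriveB (dphi s sr) (is_deriveZ (b m.+1) dX).
  rewrite (_ : _ - _ = g); last by apply/funext => x; rewrite /g !fctE.
  move=> D; apply: is_derive_eq D _.
  by rewrite /g' /pseries_diffs /GRing.scale /=; ring.
have g0 : g 0 = 0 by rewrite /g (has_pseries_at0 r0 H) b0 // expr0n /= mulr0 subr0.
have abs_lt (s : R) : 0 <= s -> s <= t -> `|s| < r.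
  by move=> s0 st; rewrite ger0_norm // (le_lt_trans st).
have i0t : is_interval [set s : R | 0 <= s <= t].
  by move=> x y /andP[x0 _] /andP[_ yt] z /andP[xz zy]; rewrite /= (le_trans x0) //= (le_trans zy).
have dgt s : [set s : R | 0 <= s <= t] s -> is_derive s 1 g (g' s).
  by move=> /andP[s0 st]; apply/dg/abs_lt.
have in0 : [set s : R | 0 <= s <= t] 0 by rewrite /= lexx ltW.
have int : [set s : R | 0 <= s <= t] t by rewrite /= lexx ltW.
have [s /andP[s0 st] E] := MVT_on i0t dgt in0 int t0.
move: E; rewrite g0 !subr0 => E; rewrite -/(g t) E normrM (gtr0_norm t0) exprSr mulrA.
rewrite ler_wpM2r ?(ltW t0) //; apply: le_trans (He s _) _.
  by rewrite s0 (lt_trans st).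
by rewrite ler_wpM2l ?(ltW dl0) // lerXn2r ?nnegrE ?ltW.
Qed.

(** Negative exponents appear once [power_like] has differentiated past the order [mu]. Then
    [c = 0], and the claim holds because [phi] is bounded near 0 while [t ^ mu] blows up. *)
Lemma has_pseries_close (mu : int) b r phi (c dl : R) : 0 < r -> 0 < dl ->
  has_pseries b r phi -> (forall j : nat, (j%:Z < mu)%R -> b j = 0) ->
  (forall j : nat, j%:Z = mu -> b j = c) -> ((mu < 0)%R -> c = 0) ->
  exists2 eps : R, 0 < eps &
    forall t : R, 0 < t < eps -> `|phi t - c * t ^ mu| <= dl * t ^ mu.
Proof.
move=> r0 dl0 H; case: mu => m bmu bc cmu.
  have [j jm|eps eps0 He] := @has_pseries_leading m b r phi r0 H _ dl dl0.
    by apply: bmu; rewrite ltz_nat.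
  by exists eps => // t /He; rewrite bc.
have [eps eps0 He] := has_pseries_cont0 r0 H ltr01.
have B0 : 0 < `|b 0%N| + 1 by rewrite ltr_wpDl.
exists (Num.min eps (Num.min 1 (dl / (`|b 0%N| + 1)))).
  by rewrite !lt_min eps0 ltr01 divr_gt0.
move=> t; rewrite !lt_min => /and4P[t0 te t1 tdl]; rewrite cmu // mul0r subr0.
have /He hb : `|t| < eps by rewrite gtr0_norm.
apply: (@le_trans _ _ (`|b 0%N| + 1)).
  rewrite -(subrK (b 0%N) (phi t)) (le_trans (ler_normD _ _)) // addrC lerD2l //.
rewrite /exprz ler_pdivlMr ?exprn_gt0 // mulrC -ler_pdivlMr // ltW //.
apply: le_lt_trans tdl; rewrite exprS ler_piMr ?(ltW t0) //.
by rewrite exprn_ile1 ?(ltW t0) ?(ltW t1).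
Qed.

(** The three conditions on the coefficients survive differentiation; on passing from exponent 0 to
    -1 the new coefficient [c * 0] vanishes. *)
Lemma has_pseries_power_like k (mu : int) b r phi (c dl : R) : 0 < r -> 0 < dl ->
  has_pseries b r phi -> (forall j : nat, (j%:Z < mu)%R -> b j = 0) ->
  (forall j : nat, j%:Z = mu -> b j = c) -> ((mu < 0)%R -> c = 0) ->
  exists2 eps : R, 0 < eps & forall K : set R,
    (forall x, K x -> 0 < x < eps) -> power_like k K dl c mu phi.
Proof.
move=> r0 dl0; elim: k mu b phi c => [|k IH] mu b phi c H bmu bc cmu;
  have [eps eps0 He] := has_pseries_close r0 dl0 H bmu bc cmu.
  by exists eps => // K Kp; split => // x /Kp; exact: He.
have [phi' H' dphi] := has_pseries_derive H.
have [j jmu|j jmu|mu0|eps' eps'0 He'] := IH (mu - 1) _ phi' (c * mu%:~R) H'.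
- by rewrite /pseries_diffs bmu ?mulr0 //; move: jmu; clear; lia.
- have mj : mu = j.+1%:Z by move: jmu; clear; lia.
  by rewrite /pseries_diffs (bc j.+1) // mj mulrC.
- have [muneg|muge] := ltP mu 0; first by rewrite cmu ?mul0r.
  have -> : mu = 0 by move: mu0 muge; clear; lia.
  by rewrite mulr0.
exists (Num.min r (Num.min eps eps')); first by rewrite !lt_min r0 eps0.
move=> K Kp; split=> [x /Kp|].
  by rewrite !lt_min => /and4P[x0 _ xe _]; apply: He; rewrite x0.
exists phi' => [x /Kp|]; last first.
  by apply: He' => x /Kp; rewrite !lt_min => /and4P[-> _ _ ->].
by rewrite !lt_min => /and4P[x0 xr _ _]; apply: dphi; rewrite gtr0_norm.
Qed.

End PowerSeries.

(** * Gaussian elimination on coefficient sequences *)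

Section Echelon.
Set Implicit Arguments.
Unset Strict Implicit.
Context {R : realType} {I : eqType}.
Implicit Types (s p : seq I) (b : I -> nat -> R).

Definition independent s b := forall c : I -> R,
  (forall k, \sum_(i <- s) c i * b i k = 0) -> {in s, forall i, c i = 0}.

(** The pivot is a sequence of least order; subtracting multiples of it from the others raises their
    orders. [k0] is a lower bound for the orders, which makes the exponents increase strictly along
    the induction; [P] carries along a property stable under linear combinations, later
    convergence. *)
Lemma echelon (P : (nat -> R) -> Prop) (n : nat) s b (i0 : I) (k0 : nat) :
  (forall (a : R) u v, P u -> P v -> P (fun k => u k + a * v k)) ->
  size s = n -> uniq s -> independent s b -> {in s, forall i, P (b i)} ->
  {in s, forall i k, (k < k0)%N -> b i k = 0} ->
  exists p (mu : nat -> nat) (beta L : nat -> nat -> R),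
  [/\ perm_eq p s,
    (forall i j, (i < j)%N -> (j < n)%N -> (mu i < mu j)%N) /\
    (forall j, (j < n)%N -> (k0 <= mu j)%N),
    forall j, (j < n)%N -> [/\ P (beta j), beta j (mu j) != 0
                             & forall k, (k < mu j)%N -> beta j k = 0],
    (forall i j, (i < j)%N -> (j < n)%N -> L i j = 0) /\
    (forall i, (i < n)%N -> L i i != 0)
  & forall i k, (i < n)%N -> b (nth i0 p i) k = \sum_(j < n) L i j * beta j k].
Proof.
move=> Plin; elim: n s b k0 => [|n IH] s b k0 sn us ind Ps bk0.
  move/size0nil: sn => ->; exists [::], id, (fun _ _ => 0), (fun _ _ => 0).
  by split.
have exk : exists k, has (fun i => b i k != 0) s.
  apply: contrapT => no; have b0 i k : i \in s -> b i k = 0.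
    by move=> si; apply/eqP/negPn/negP => bi; apply: no; exists k; apply/hasP; exists i.
  have /hasP[i si _] : has predT s by rewrite has_predT sn.
  have sum0 k : \sum_(i <- s) 1 * b i k = 0.
    by rewrite big_seq big1 // => j js; rewrite b0 ?mulr0.
  by have /eqP := ind (fun _ => 1) sum0 i si; rewrite oner_eq0.
have [m /hasP[q qs bqm] mmin] := ex_minnP exk.
have b0 i k : i \in s -> (k < m)%N -> b i k = 0.
  move=> si km; apply/eqP/negPn/negP => bi; move: km; rewrite ltnNge mmin //.
  by apply/hasP; exists i.
pose s' := rem q s; pose a i := b i m / b q m.
pose b' i k := b i k + - a i * b q k.
have subs i : i \in s' -> i \in s by exact: mem_rem.
have sE : perm_eq s (q :: s') := perm_to_rem qs.
have us' : uniq s' by exact: rem_uniq.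
have qs' : q \notin s' by rewrite mem_rem_uniq // inE eqxx.
have [|||i si|i si k|p [mu [beta [L [ps [muI muk] bP [L0 LP] bE]]]]] :=
  IH s' b' m.+1.
- by rewrite size_rem // sn.
- exact: us'.
- move=> c cE i si.
  (* A relation among the reduced sequences becomes one among the original ones when the pivot
     receives this coefficient. *)
  pose c' j := if j == q then - \sum_(j <- s') c j * a j else c j.
  have c'q : c' q = - \sum_(j <- s') c j * a j by rewrite /c' eqxx.
  have c's j : j \in s' -> c' j = c j.
    by move=> sj; rewrite /c'; case: eqP => // jq; move: qs'; rewrite -jq sj.
  rewrite -(c's i si); apply: ind => [k|]; last exact: subs.
  rewrite (perm_big _ sE) /= big_cons c'q -[RHS](cE k) mulNr mulr_suml addrC.
  rewrite -sumrB big_seq [RHS]big_seq; apply: eq_bigr => j sj.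
  by rewrite c's // /b'; ring.
- by apply: Plin; apply: Ps => //; exact: subs.
- rewrite ltnS leq_eqVlt => /predU1P[->|km]; rewrite /b' /a.
    by rewrite mulNr divfK // subrr.
  by rewrite (b0 i k (subs i si) km) (b0 q k qs km) mulr0 addr0.
exists (q :: p), (fun j => if j is j'.+1 then mu j' else m),
  (fun j => if j is j'.+1 then beta j' else b q),
  (* Column 0 stores the multipliers of the pivot; row 0 is the pivot itself. *)
  (fun i j => if i is i'.+1 then if j is j'.+1 then L i' j' else a (nth i0 p i')
              else (j == 0%N)%:R).
have k0m : (k0 <= m)%N.
  by rewrite leqNgt; apply/negP => mk0; move: bqm; rewrite bk0 ?eqxx.
split.
- by rewrite perm_sym (perm_trans sE) // perm_cons perm_sym.
- split=> [[|i] [|j] // ij jn|[|j] jn] //; [exact: muk|exact: muI|].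
  by apply: leq_trans (muk j jn); rewrite leqW.
- move=> [|j] jn; last exact: bP.
  by split => //; [exact: Ps|move=> k; exact: b0].
- by split=> [[|i] [|j] // ij jn|[|i] jn]; [exact: L0|rewrite oner_eq0|exact: LP].
- move=> [|i] k jn; rewrite big_ord_recl /=.
    by rewrite mul1r big1 ?addr0 // => j _; rewrite mul0r.
  by rewrite -bE // /b'; ring.
Qed.

End Echelon.

(** * One-sided growth at a point and the identity theorem *)

Section Local.
Set Implicit Arguments.
Unset Strict Implicit.
Context {R : realType}.
Implicit Types (b : nat -> R) (r : R) (phi : R -> R).

Lemma has_pseries_sum n (c : 'I_n -> R) (b : 'I_n -> nat -> R) (phi : 'I_n -> R -> R) r :
  (forall i, has_pseries (b i) r (phi i)) ->
  has_pseries (fun k => \sum_(i < n) c i * b i k) r (fun t => \sum_(i < n) c i * phi i t).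
Proof.
elim: n c b phi => [|n IH] c b phi H.
  have -> : (fun k : nat => \sum_(i < 0) c i * b i k) = (fun=> 0).
    by apply/funext => k; rewrite big_ord0.
  move=> t _; rewrite big_ord0 /pseries.
  rewrite (_ : series _ = cst 0); first exact: cvg_cst.
  by apply/funext => k; rewrite /series /= big1 // => i _; rewrite mul0r.
have IHn := IH (fun i => c (widen_ord (leqnSn n) i)) _ _ (fun i => H (widen_ord (leqnSn n) i)).
have := @has_pseries_lin _ (c ord_max) _ _ _ _ _ IHn (H ord_max).
congr (has_pseries _ _ _); apply/funext => x; exact/esym/big_ord_recr.
Qed.

(** Elimination is applied to the series of the derivatives. The reduced series have sums that
    behave like their leading terms, so [uniform_growth] applies on a short interval to the right of
    0. *)
Lemma local_growth m (g : 'I_m.+1 -> R -> R) (a : 'I_m.+1 -> nat -> R) r : 0 < r ->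
  (forall i, has_pseries (a i) r (g i)) ->
  independent (enum 'I_m.+1) (fun i => pseries_diffs (a i)) ->
  exists2 eps : R, 0 < eps & exists2 C : R, 0 < C &
  forall A : {fset R}, A != fset0 -> {in A, forall x, 0 < x < eps} ->
  exists i, C * #|` A|%:R `^ phi R m.+1 <= #|` sumdiff_between m (g i @` A)%fset|%:R.
Proof.
move=> r0 ga ind.
have /boolp.choice[g' g'P] : forall i, exists g', has_pseries (pseries_diffs (a i)) r g' /\
    forall t : R, `|t| < r -> is_derive t 1 (g i) (g' t).
  by move=> i; have [g' h d] := has_pseries_derive (ga i); exists g'.
have [||||||p [mu [beta [L [ps [muI _] bP [L0 LP] bE]]]]] :=
  @echelon R _ (fun u => exists phi, has_pseries u r phi) m.+1 (enum 'I_m.+1)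
    (fun i => pseries_diffs (a i)) ord0 0.
- by move=> x u v [phi hp] [psi hq]; exists (fun t => phi t + x * psi t); exact: has_pseries_lin.
- by rewrite size_enum_ord.
- exact: enum_uniq.
- exact: ind.
- by move=> i _; exists (g' i); case: (g'P i).
- by [].
pose c j := beta j (mu j).
have tr : triangular m mu c L.
  by split => // j jm; case: (bP j jm).
have [dl dl0 [C C0 H]] := uniform_growth tr.
have /boolp.choice[e eP] : forall j, exists e, (j < m.+1)%N -> has_pseries (beta j) r e.
  move=> j; have [jm|] := boolP (j < m.+1)%N; last by exists id.
  by have [[e he] _ _] := bP j jm; exists e.
have /boolp.choice[d dP] : forall j, exists d : R, (j <= m)%N -> 0 < d /\
    forall K : set R, (forall x, K x -> 0 < x < d) -> power_like m K dl (c j) (mu j) (e j).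
  move=> j; have [jm|] := boolP (j <= m)%N; last by exists 0.
  have [_ _ b0] := bP j jm.
  have [k|k|//|d d0 dP] :=
    @has_pseries_power_like R m (mu j) (beta j) r (e j) (c j) dl r0 dl0 (eP j jm).
  - by rewrite ltz_nat; exact: b0.
  - by move=> /eqP; rewrite eqz_nat => /eqP->.
  by exists d.
have [d1 d10 d1P] := @common_bound R m d (fun j jm => (dP j jm).1).
pose eps := Num.min d1 (Num.min dl r).
exists eps; first by rewrite !lt_min d10 dl0.
exists C => // A An0 AK.
pose K : set R := [set` `]0, eps[].
have Kp x : K x -> [/\ 0 < x, x < d1, x < dl & x < r].
  by rewrite /K /= in_itv /= !lt_min => /and4P[].
have [||i im iC] := H K (fun i => g (nth ord0 p i)) e _ I A An0; last by exists (nth ord0 p i).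
  split.
  - exact: interval_open.
  - exact: interval_is_interval.
  - by move=> x /Kp[].
  - by move=> x /Kp[].
  split=> [j jm|i x im /Kp[x0 _ _ xr]].
    have [_ P] := dP j jm; apply: P => x /Kp[-> xd _ _].
    by rewrite (lt_le_trans xd) ?d1P.
  have xr' : `|x| < r by rewrite gtr0_norm.
  have [h' dg] := g'P (nth ord0 p i); have := dg x xr'.
  suff -> : g' (nth ord0 p i) x = \sum_(j < m.+1) L i j * e j x by [].
  have hs := @has_pseries_sum m.+1 (fun j => L i j) (fun j => beta j) (fun j => e j) r
    (fun j => eP j (ltn_ord j)).
  suff h2 : has_pseries (pseries_diffs (a (nth ord0 p i))) r
      (fun t => \sum_(j < m.+1) L i j * e j t) by exact: (has_pseries_unique h' h2 xr').
  move: hs.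
  by congr (has_pseries _ _ _); apply/funext => k; rewrite -bE.
by move=> x xA; rewrite /K /= in_itv; exact: AK.
Qed.

(** The first nonzero coefficient dominates for small positive [t]; reflection treats negative [t].
    Zeros are thus isolated unless the series vanishes. *)
Lemma has_pseries_dichotomy b r phi : 0 < r -> has_pseries b r phi ->
  (forall k, b k = 0) \/
  exists2 eps : R, 0 < eps & forall t, 0 < `|t| < eps -> phi t != 0.
Proof.
move=> r0 H; have [[k bk]|no] := pselect (exists k, b k != 0); last first.
  by left=> k; apply/eqP/negPn/negP => bk; apply: no; exists k.
right; have exk : exists k, b k != 0 by exists k.
have [m bm mmin] := ex_minnP exk.
have b0 j : (j < m)%N -> b j = 0.
  by move=> jm; apply/eqP/negPn/negP => /mmin; rewrite leqNgt jm.
have right psi v : has_pseries v r psi -> v m != 0 -> (forall j, (j < m)%N -> v j = 0) ->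
    exists2 eps : R, 0 < eps & forall t, 0 < t < eps -> psi t != 0.
  move=> Hv vm v0; have dl0 : 0 < `|v m| / 2 by rewrite divr_gt0 // normr_gt0.
  have [eps eps0 He] := has_pseries_leading r0 Hv v0 dl0; exists eps => // t te.
  apply/eqP => pt; have := He t te; rewrite pt sub0r normrN normrM.
  have t0 : 0 < t ^+ m by rewrite exprn_gt0 //; case/andP: te.
  rewrite (gtr0_norm t0) ler_pM2r //; move: dl0; clear; lra.
have [e1 e10 H1] := right phi b H bm b0.
have [||e2 e20 H2] := right _ _ (has_pseriesN H).
- by rewrite mulf_neq0 // signr_eq0.
- by move=> j /b0->; rewrite mulr0.
exists (Num.min e1 e2); first by rewrite lt_min e10.
move=> t /andP[]; rewrite normr_gt0 lt_min => t0 /andP[te1 te2].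
have [tpos|tneg|teq] := ltgtP 0 t; last by move: t0; rewrite -teq eqxx.
  by apply: H1; rewrite tpos -(gtr0_norm tpos).
by rewrite -(opprK t); apply: H2; rewrite oppr_gt0 tneg -(ltr0_norm tneg).
Qed.

(** The interior of the zero set is open, and closed relative to [J] because at a limit point of it
    the zeros are not isolated; connectedness of [J] concludes. *)
Lemma identity_theorem (J : set R) (h : R -> R) (x0 : R) : is_interval J ->
  (forall x, J x -> exists2 r : R, 0 < r & exists b, has_pseries b r (fun t => h (x + t))) ->
  J x0 -> (\forall x \near x0, h x = 0) -> forall x, J x -> h x = 0.
Proof.
move=> /connected_intervalP cJ ps Jx0 hx0.
pose Z := interior [set x | h x = 0].
suff JZ : J `&` Z = J by move=> x; rewrite -{1}JZ => -[_ /nbhs_singleton].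
apply: cJ.
- by exists x0.
- by exists Z => //; exact: open_interior.
exists (closure Z); first exact: closed_closure.
apply/seteqP; split=> x [Jx xZ]; split => //; first exact: subset_closure.
have [r r0 [b H]] := ps x Jx.
have [b0|[eps eps0 He]] := has_pseries_dichotomy r0 H.
  apply/nbhs_ballP; exists r => // y; rewrite /ball /= => xy.
  have := H (y - x); rewrite distrC xy (addrC x) subrK => /(_ isT) Hy.
  apply: cvg_unique Hy _ => //.
  rewrite /pseries (_ : series _ = cst 0); first exact: cvg_cst.
  by apply/funext => k; rewrite /series /= big1 // => i _; rewrite b0 mul0r.
have [|z [zZ xz]] := xZ (ball x eps); first exact: nbhsx_ballx.
have [->//|zx] := eqVneq x z.
have hz : h z = 0 by exact: (nbhs_singleton zZ).
suff /He : 0 < `|z - x| < eps by rewrite (addrC x) subrK hz eqxx.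
by rewrite normr_gt0 subr_eq0 eq_sym zx distrC; exact: xz.
Qed.


End Local.

(** * From local growth to a compact interval *)

Section Global.
Set Implicit Arguments.
Unset Strict Implicit.
Context {R : realType}.
Context (m : nat) (f : 'I_m.+1 -> R -> R).
Implicit Types (E : set R).

(** The index [i] may depend on [A] while [C] may not, so the property passes to finite unions. *)
Definition expands_on E := exists2 C : R, 0 < C &
  forall A : {fset R}, A != fset0 -> {in A, forall x, E x} ->
  exists i, C * #|` A|%:R `^ phi R m.+1 <=
            #|` sumdiff (2 ^ m) (2 ^ m - 1) (f i @` A)%fset|%:R.

Lemma card_sumdiff_between_le (B : {fset R}) :
  (#|` sumdiff_between m B| <= #|` sumdiff (2 ^ m) (2 ^ m - 1) B|)%N.
Proof. by apply/fsubset_leq_card/fsubsetP => z /sumdiff_betweenP[]. Qed.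

Lemma expands_onS E E' : E' `<=` E -> expands_on E -> expands_on E'.
Proof.
by move=> EE' [C C0 H]; exists C => // A An0 AE; apply: H => // x /AE /EE'.
Qed.

Lemma expands_on1 x0 : expands_on [set x0].
Proof.
exists 1 => // A An0 Ax; exists ord0.
have A1 : (#|` A| <= 1)%N.
  rewrite -(cardfs1 x0); apply/fsubset_leq_card/fsubsetP => x /Ax ->.
  by rewrite inE.
have -> : #|` A| = 1%N by apply/eqP; rewrite eqn_leq A1 cardfs_gt0.
rewrite mul1r powR1 ler1n; apply: leq_trans (card_sumdiff_between_le _).
have /fset0Pn[x xA] := An0; rewrite cardfs_gt0; apply/fset0Pn; exists (f ord0 x).
by apply: (fsubsetP (sub_sumdiff_between _ _)); rewrite in_imfset.
Qed.

Lemma expands_on0 : expands_on set0.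
Proof. exact: expands_onS (@sub0set _ _) (expands_on1 0). Qed.

Lemma expands_onU E E' : expands_on E -> expands_on E' -> expands_on (E `|` E').
Proof.
move=> [C C0 H] [C' C'0 H']; have p0 := phi_gt0 (R := R) m.
pose D := Num.min C C' * (2^-1 `^ phi R m.+1).
have m0 : 0 < Num.min C C' by rewrite lt_min C0.
exists D; first by rewrite mulr_gt0 // powR_gt0.
have part (X A : {fset R}) (C1 : R) (E1 : set R) : Num.min C C' <= C1 ->
    (forall A : {fset R}, A != fset0 -> {in A, forall x, E1 x} ->
       exists i, C1 * #|` A|%:R `^ phi R m.+1 <=
            #|` sumdiff (2 ^ m) (2 ^ m - 1) (f i @` A)%fset|%:R) ->
    A != fset0 -> (X `<=` A)%fset -> (#|` A| <= 2 * #|` X|)%N -> {in X, forall x, E1 x} ->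
    exists i, D * #|` A|%:R `^ phi R m.+1 <=
            #|` sumdiff (2 ^ m) (2 ^ m - 1) (f i @` A)%fset|%:R.
  move=> mC1 H1 An0 XA AX XE.
  have Xn0 : X != fset0.
    by rewrite -cardfs_gt0; move: AX An0; rewrite -cardfs_gt0; case: #|` X|; lia.
  have [i iC] := H1 X Xn0 XE; exists i.
  apply: (@le_trans _ _ #|` sumdiff (2 ^ m) (2 ^ m - 1) (f i @` X)%fset|%:R).
    apply: le_trans iC; rewrite /D -mulrA -powRM ?invr_ge0 //.
    apply: ler_pM; rewrite ?powR_ge0 ?(ltW m0) //.
    rewrite ge0_ler_powR ?nnegrE ?(ltW p0) ?mulr_ge0 ?invr_ge0 //.
    by rewrite mulrC ler_pdivrMr // mulrC -natrM ler_nat.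
  rewrite ler_nat; apply/fsubset_leq_card/sumdiffS/fsubsetP => _ /imfsetP[x /= xX ->].
  by rewrite in_imfset //=; exact: (fsubsetP XA).
move=> A An0 AE.
pose X := [fset x in A | `[< E x >]]%fset; pose X' := [fset x in A | ~~ `[< E x >]]%fset.
have AX : (#|` A| <= #|` X| + #|` X'|)%N.
  apply: (@leq_trans #|` (X `|` X')%fset|); last by rewrite cardfsU leq_subr.
  by apply/fsubset_leq_card/fsubsetP => x xA; rewrite !inE xA orbN.
have [XX'|X'X] := leqP #|` X'| #|` X|.
  apply: (part X A C E) => //; first by rewrite ge_min lexx.
  - by apply/fsubsetP => x; rewrite !inE => /andP[].
  - by rewrite mul2n -addnn (leq_trans AX) // leq_add2l.
  - by move=> x; rewrite !inE => /andP[_ /asboolP].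
apply: (part X' A C' E') => //; first by rewrite ge_min lexx orbT.
- by apply/fsubsetP => x; rewrite !inE => /andP[].
- by rewrite mul2n -addnn (leq_trans AX) // leq_add2r ltnW.
- by move=> x; rewrite !inE => /andP[xA /asboolPn nE]; case: (AE x xA).
Qed.

Lemma expands_on_seq (s : seq R) (U : R -> set R) : {in s, forall x, expands_on (U x)} ->
  expands_on [set y | exists2 x, x \in s & U x y].
Proof.
elim: s => [|x s IH] H; first by apply: expands_onS expands_on0 => y [].
have H1 : expands_on (U x) by apply: H; rewrite inE eqxx.
have H2 := IH (fun y ys => H y (mem_behead (s := x :: s) ys)).
apply: expands_onS (expands_onU H1 H2) => y [z]; rewrite inE => /predU1P[->|zs] Uz.
  by left.
by right; exists z.
Qed.

Lemma expands_on_compact (K : set R) : compact K ->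
  (forall x, K x -> exists2 e : R, 0 < e & expands_on (ball x e)) -> expands_on K.
Proof.
rewrite compact_cover => cK loc.
have /boolp.choice[e eP] : forall x, exists e : R, K x -> 0 < e /\ expands_on (ball x e).
  move=> x; have [Kx|] := pselect (K x); last by exists 0.
  by have [e e0 He] := loc x Kx; exists e.
have [|x Kx|D DK KD] := cK R K (fun x => ball x (e x)).
- by move=> x _; exact: ball_open.
- by exists x => //; apply: ballxx; case: (eP x Kx).
apply: (expands_onS _ (expands_on_seq (s := D) (U := fun x => ball x (e x)) _)).
  by move=> y /KD[x xD yx]; exists x.
by move=> x /DK; rewrite inE => /eP[].
Qed.

(* Applied with [s = 1] and [s = -1], one for each side of [x0]. *)
Lemma expands_on_image E (s x0 eps C : R) : s != 0 -> 0 < C ->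
  (forall x, E x -> 0 < s * (x - x0) < eps) ->
  (forall A : {fset R}, A != fset0 -> {in A, forall x, 0 < x < eps} ->
    exists i, C * #|` A|%:R `^ phi R m.+1 <=
      #|` sumdiff_between m ((fun t => f i (x0 + s^-1 * t)) @` A)%fset|%:R) ->
  expands_on E.
Proof.
move=> s0 C0 Ee H; exists C => // A An0 AE.
pose A' := ((fun x => s * (x - x0)) @` A)%fset.
have cA' : #|` A'| = #|` A|.
  by apply: card_imfset => x y /(mulfI s0) /addIr.
have [||i iC] := H A'.
- by rewrite -cardfs_gt0 cA' cardfs_gt0.
- by move=> _ /imfsetP[x /AE /Ee xe ->].
exists i; move: iC; rewrite cA'.
have -> : ((fun t => f i (x0 + s^-1 * t)) @` A')%fset = (f i @` A)%fset.
  rewrite /A' -imfset_comp; apply: eq_in_imfset => // x _ /=.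
  by rewrite mulKf // addrC subrK.
by move=> /le_trans; apply; rewrite ler_nat card_sumdiff_between_le.
Qed.

(** The ball is the union of its centre and two sides, each handled by [local_growth] in the
    coordinate given by the distance to [x0]. *)
Lemma expands_locally (J : set R) (x0 : R) : is_interval J ->
  (forall i, analytic_on J (f i)) -> one_independent_on J f -> J x0 ->
  exists2 e : R, 0 < e & expands_on (ball x0 e).
Proof.
move=> iJ an ind Jx0.
have ps x : J x -> exists2 r : R, 0 < r & exists a : 'I_m.+1 -> nat -> R,
    (forall i, has_pseries (a i) r (fun t => f i (x + t))) /\
    forall i, has_pseries (pseries_diffs (a i)) r (fun t => derive1 (f i) (x + t)).
  move=> Jx; have /boolp.choice[w wP] : forall i, exists w : R * (nat -> R), 0 < w.1 /\
      has_pseries w.2 w.1 (fun t => f i (x + t)).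
    move=> i; have [r r0 [c H]] := an i x Jx; exists (r, c); split => // t tr.
    by have := H (x + t); rewrite addrAC subrr add0r; exact.
  have [r r0 rP] := @common_bound R m (fun k => (w (inord k)).1) (fun k _ => (wP (inord k)).1).
  have {}rP i : r <= (w i).1 by have := rP i; rewrite inord_val; apply; rewrite -ltnS.
  exists r => //; exists (fun i => (w i).2).
  have wr i : has_pseries (w i).2 r (fun t => f i (x + t)).
    by move=> t tr; apply: (wP i).2; exact: lt_le_trans tr (rP i).
  split=> // i; have [g' hg dg] := has_pseries_derive (wr i) => t tr.
  suff -> : derive1 (f i) (x + t) = g' t by exact: hg.
  have D : is_derive (x + t) 1 (fun y => y - x) (1 : R).
    by apply: is_derive_eq (is_deriveB (is_derive_id _ _) (is_derive_cst x _ _)) _; rewrite subr0.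
  have dgt : is_derive (x + t - x) 1 (fun t => f i (x + t)) (g' t).
    by rewrite addrAC subrr add0r; exact: dg.
  have := @is_derive1_comp R (fun t => f i (x + t)) (fun y => y - x) (x + t) _ _ dgt D.
  rewrite (_ : _ \o _ = f i); last by apply/funext => y /=; rewrite addrC subrK.
  by rewrite mulr1 derive1E => -[].
have [r r0 [a [ha hd]]] := ps x0 Jx0.
(* A relation between the Taylor coefficients at [x0] makes the combination of derivatives vanish
   near [x0], hence on all of [J] by the identity theorem, contradicting independence unless the
   relation is trivial. *)
have inda : independent (enum 'I_m.+1) (fun i => pseries_diffs (a i)).
  move=> c cE i _; apply: (ind c _ i) => x Jx.
  apply: (identity_theorem iJ _ Jx0 _ Jx (h := fun x => \sum_(i < m.+1) c i * derive1 (f i) x)).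
    move=> y /ps[ry ry0 [ay [_ hy]]]; exists ry => //.
    exists (fun k => \sum_(i < m.+1) c i * pseries_diffs (ay i) k).
    exact: has_pseries_sum.
  have hs := @has_pseries_sum R m.+1 c _ _ r hd.
  apply/nbhs_ballP; exists r => // y; rewrite /ball /= => yr.
  have := hs (y - x0); rewrite /= distrC (addrC x0 (y - x0)) subrK => /(_ yr) Hy.
  apply: cvg_unique Hy _ => //.
  rewrite /pseries (_ : series _ = cst 0); first exact: cvg_cst.
  apply/funext => k; rewrite /series /= big1 // => j _.
  by have := cE j; rewrite big_enum /= => ->; rewrite mul0r.
have [e1 e10 [C1 C10 H1]] := local_growth r0 ha inda.
have ha' i := has_pseriesN (ha i).
have [|e2 e20 [C2 C20 H2]] := local_growth r0 ha'.
  move=> c cE; apply: inda => k.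
  (* Reflection multiplies the coefficients of index [k] by a nonzero factor that does not depend on
     [i], so independence is preserved. *)
  have := cE k; rewrite (eq_bigr (fun i => - (-1) ^+ k * (c i * pseries_diffs (a i) k))).
    rewrite -mulr_sumr => /eqP; rewrite mulf_eq0 oppr_eq0 signr_eq0 => /eqP//.
  by move=> i _; rewrite /pseries_diffs exprS; ring.
exists (Num.min e1 e2); first by rewrite lt_min e10.
have right : expands_on [set x | 0 < 1 * (x - x0) < e1].
  apply: (@expands_on_image _ 1 x0 e1 C1 _ C10) => // A An0 AE.
  have [i iC] := H1 A An0 AE; exists i; apply: le_trans iC _.
  suff -> : (fun t => f i (x0 + 1^-1 * t)) = (fun t => f i (x0 + t)) by [].
  by apply/funext => t; rewrite invr1 mul1r.
have left : expands_on [set x | 0 < -1 * (x - x0) < e2].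
  apply: (@expands_on_image _ (-1) x0 e2 C2 _ C20) => // A An0 AE.
  have [i iC] := H2 A An0 AE; exists i; apply: le_trans iC _.
  suff -> : (fun t => f i (x0 + (-1)^-1 * t)) = (fun t => f i (x0 - t)) by [].
  by apply/funext => t; rewrite invrN1 mulN1r.
apply: (expands_onS _ (expands_onU (expands_on1 x0) (expands_onU left right))).
move=> x; rewrite /ball /= lt_min => /andP[x1 x2].
have [xx|xx|->] := ltgtP x x0; last by left.
- by right; left; move: x2; rewrite /= gtr0_norm ?subr_gt0 // mulN1r opprB subr_gt0 xx.
- by right; right; move: x1; rewrite /= distrC gtr0_norm ?subr_gt0 // mul1r subr_gt0 xx.
Qed.

End Global.

Theorem theorem1p9 (R : realType) (a b : R) (leab : a <= b)
    (n : nat) (n_gt0 : (0 < n)%N) (J : set R)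
    (openJ : open J) (itvJ : is_interval J) (subIJ : `[a, b]%classic `<=` J)
    (f : 'I_n -> R -> R)
    (anf : forall i, analytic_on J (f i))
    (indf : one_independent_on J f) :
  exists2 C : R, 0 < C &
    forall A : {fset R}, (forall x, x \in A -> x \in `[a, b]) ->
      exists i : 'I_n,
        (#|` sumdiff (2 ^ (n - 1)) (2 ^ (n - 1) - 1) (f i @` A)%fset|)%:R
          >= C * (#|` A|)%:R `^ phi R n.
Proof.
case: n n_gt0 f anf indf => // m _ f anf indf; rewrite subn1 /=.
have [x Ix|C C0 H] := @expands_on_compact R m f _ (segment_compact (a := a) (b := b)).
  exact: (expands_locally itvJ anf indf (subIJ x Ix)).
(* For empty [A] the bound is 0, because 0 raised to a nonzero exponent is 0. *)
exists C => // A Aab; have [->|An0] := eqVneq A fset0; last by apply: H => // x /Aab.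
by exists ord0; rewrite cardfs0 powR0 ?mulr0 // gt_eqF // phi_gt0.
Qed.
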